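(* Let $n\in\mathbb{N}\cup\{0\}$, let $k\ge 2$ be an integer, let $0\le\theta<1$, and put $\theta_{\rm c}=\frac{2n+3}{k(2n+1)}$. Consider on the Cayley tree $\Gamma^k$ of order $k$, with local state space $[0,1]$, the nearest-neighbor model with Hamiltonian $H(\sigma)=-\sum_{\langle x,y\rangle\in L}\xi_{\sigma(x),\sigma(y)}$, where $$\xi_{t,u}=\log\left(1+\theta\sqrt[2n+1]{4\left(t-\tfrac12\right)\left(u-\tfrac12\right)}\right),\qquad t,u\in[0,1],$$ at $\beta=1$. Then the model has (1) a unique translation-invariant splitting Gibbs measure if $0\le\theta\le\theta_{\rm c}$, and (2) exactly three translation-invariant splitting Gibbs measures if $\theta_{\rm c}<\theta<1$.
   Context: The symbol $\sqrt[2n+1]{\cdot}$ denotes the real odd root, defined on all of $\mathbb{R}$ (negative on negative numbers). The Cayley tree $\Gamma^k=(V,L)$ of order $k$ is the infinite tree in which exactly $k+1$ edges originate from each vertex; $V$ is the vertex set and $L$ the edge set, and $\langle x,y\rangle\in L$ denotes an (unordered) edge with endpoints $x,y$. Fix a root $x^0\in V$ and, with $d$ the graph distance, let $W_N=\{x\in V: d(x,x^0)=N\}$ and $V_N=\bigcup_{i=0}^N W_i$. Configurations are functions $\sigma:V\to[0,1]$; $\Omega=[0,1]^V$ carries the sigma-algebra generated by the cylinder sets. The a priori measure on $[0,1]$ is Lebesgue measure $\lambda$, and $\lambda_A$ is the product of copies of $\lambda$ over a finite set $A\subset V$. Put $K(t,u)=\exp(\beta\xi_{t,u})$, which at $\beta=1$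 equals $1+\theta\sqrt[2n+1]{4(t-\frac12)(u-\frac12)}$, and define the Hammerstein operator $$(H_kf)(t)=\int_0^1K(t,u)f^k(u)\,du,\qquad t\in[0,1],\ f\in C[0,1],\ f\ge 0.$$ Translation-invariant splitting Gibbs measures (Markov chains) are the infinite-volume Gibbs measures represented by positive fixed points of $H_k$: a probability measure $\mu$ on $\Omega$ is a translation-invariant splitting Gibbs measure if there is $f\in C[0,1]$ with $f(t)>0$ for all $t\in[0,1]$ and $H_kf=f$ such that, for every $N\ge1$, the marginal of $\mu$ on $[0,1]^{V_N}$ has density with respect to $\lambda_{V_N}$ equal to $$\frac1{Z_N}\prod_{\langle x,y\rangle\in L,\ x,y\in V_N}K(\sigma(x),\sigma(y))\prod_{x\in W_N}f^k(\sigma(x)),$$ where $Z_N$ is the normalizing constant. (The fixed-point equation makes these marginals consistent in $N$, so each positive fixed point $f$ determines one such measure.) *)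

(* Defs.v *)
From HB Require Import structures.
From mathcomp Require Import all_boot all_order all_algebra finmap.
From mathcomp Require Import all_classical all_reals all_analysis.
From mathcomp Require Import giry.

Set Implicit Arguments.
Unset Strict Implicit.
Unset Printing Implicit Defensive.
Import Order.TTheory GRing.Theory Num.Theory.
Import numFieldNormedType.Exports.
Local Open Scope classical_set_scope.
Local Open Scope ring_scope.

Section spin.
Variable R : realType.

Definition unit_itv : Type := {x : R | 0 <= x <= 1}.

HB.instance Definition _ := Choice.on unit_itv.

Fact unit_itv0_subproof : 0 <= (0 : R) <= 1.
Proof. by rewrite lexx ler01. Qed.

HB.instance Definition _ :=
  isPointed.Build unit_itv (exist _ 0 unit_itv0_subproof).

(* [0,1] with the Borel sigma-algebra: traces on [0,1] of the Borel sets *)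
Definition spin : Type := g_sigma_algebra_preimageType (sval : unit_itv -> R).

HB.instance Definition _ := Measurable.on spin.

Definition spin_val (t : spin) : R := sval t.

Lemma spin_val_inj : injective spin_val.
Proof. exact: val_inj. Qed.

Lemma image_spin_val (C : set R) :
  spin_val @` (spin_val @^-1` C) = C `&` `[0, 1].
Proof.
apply/seteqP; split => [_ [t Ct <-]|x [Cx]]/=.
  by split => //=; rewrite in_itv/=; exact: (valP t).
by rewrite in_itv/= => x01; exists (exist _ x x01).
Qed.

Lemma measurable_image_spin (B : set spin) :
  measurable B -> measurable (spin_val @` B).
Proof.
move=> [C mC <-]; rewrite setTI -/spin_val image_spin_val.
exact: measurableI.
Qed.

Lemma measurable_spin_val : measurable_fun [set: spin] spin_val.
Proof. by move=> _ B mB; rewrite setTI; exists B => //; rewrite setTI. Qed.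

Definition spin_lebesgue (B : set spin) : \bar R :=
  lebesgue_measure (spin_val @` B).

Let spin_lebesgue0 : spin_lebesgue set0 = 0%E.
Proof. by rewrite /spin_lebesgue image_set0 measure0. Qed.

Let spin_lebesgue_ge0 B : (0 <= spin_lebesgue B)%E.
Proof. exact: measure_ge0. Qed.

Let spin_lebesgue_semi_sigma_additive : semi_sigma_additive spin_lebesgue.
Proof.
move=> F mF tF mUF; rewrite /spin_lebesgue image_bigcup.
apply: measure_semi_sigma_additive.
- by move=> i; exact: measurable_image_spin.
- apply/trivIsetP => i j _ _ ij; rewrite -subset0.
  move=> _ [[s Fis <-] [t Fjt /spin_val_inj ts]].
  have : (F i `&` F j) s by split => //; rewrite -ts.
  by move/trivIsetP : tF => ->.
- by rewrite -image_bigcup; exact: measurable_image_spin.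
Qed.

HB.instance Definition _ := isMeasure.Build _ _ _ spin_lebesgue
  spin_lebesgue0 spin_lebesgue_ge0 spin_lebesgue_semi_sigma_additive.

Let spin_lebesgue_setT : spin_lebesgue setT = 1%E.
Proof.
rewrite /spin_lebesgue -(preimage_setT spin_val) image_spin_val setTI.
by rewrite lebesgue_measure_itv/= lte_fin ltr01 oppr0 adde0.
Qed.

HB.instance Definition _ :=
  Measure_isProbability.Build _ _ _ spin_lebesgue spin_lebesgue_setT.

End spin.

Section config.
Context (I : Type) d (T : measurableType d).

Definition config : Type := I -> T.

HB.instance Definition _ := Pointed.on config.

Definition cylinders : set (set config) :=
  \bigcup_i preimage_set_system setT (fun s : config => s i) measurable.

Definition config_display : measure_display := sigma_display cylinders.

HB.instance Definition _ := @isMeasurable.Build config_display config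
  <<s cylinders >> (@sigma_algebra0 _ setT cylinders)
  (@sigma_algebraC _ cylinders) (@sigma_algebra_bigcup _ setT cylinders).

Lemma measurable_coord (i : I) :
  measurable_fun [set: config] (fun s : config => s i).
Proof.
move=> _ B mB; rewrite setTI; apply: sub_sigma_algebra.
by exists i => //; exists B => //; rewrite setTI.
Qed.

Lemma measurable_configP d' (S : measurableType d') (f : S -> config) :
  (forall i, measurable_fun setT (fun s => f s i)) -> measurable_fun setT f.
Proof.
move=> mf; apply: (@measurability _ _ _ _ _ _ cylinders) => //.
move=> _ [_ [i _ [B mB <-]] <-]; rewrite setTI.
exact: (mf i measurableT B mB).
Qed.

End config.

Section product_probability.
Context d (T : measurableType d) (R : realType) (P : probability T R).

Let cons_tuple n (x : T * n.-tuple T) : n.+1.-tuple T := [tuple of x.1 :: x.2].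

Let measurable_cons_tuple n : measurable_fun setT (@cons_tuple n).
Proof. exact: measurable_cons. Qed.

HB.instance Definition _ n :=
  isMeasurableFun.Build _ _ _ _ (@cons_tuple n) (@measurable_cons_tuple n).

Fixpoint tuple_probability n : probability (n.-tuple T) R :=
  match n with
  | 0 => \d_ [tuple]
  | m.+1 => distribution (P \x tuple_probability m)%E (@cons_tuple m)
  end.

Variable I : finType.

Let config_of_tuple (t : #|I|.-tuple T) : config I T :=
  fun i => tnth t (enum_rank i).

Let measurable_config_of_tuple : measurable_fun setT config_of_tuple.
Proof. by apply: measurable_configP => i; exact: measurable_tnth. Qed.

HB.instance Definition _ :=
  isMeasurableFun.Build _ _ _ _ config_of_tuple measurable_config_of_tuple.

Definition product_probability : probability (config I T) R :=
  distribution (tuple_probability #|I|) config_of_tuple.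

End product_probability.

Section graph.
Context (V : choiceType) (e : rel V).

Definition walk (x y : V) (m : nat) : Prop :=
  exists p : seq V, [/\ path e x p, last x p = y & size p = m].

(* length of a shortest walk; 0 by convention if there is none *)
Definition gdist (x y : V) : nat :=
  if pselect (exists m, `[< walk x y m >]) is left h then ex_minn h else 0%N.

Definition graph_sphere (x0 : V) (N : nat) : set V := [set x | gdist x x0 = N].

(* the empty finite set by convention if the ball is infinite, which does not
   happen in a locally finite graph *)
Definition graph_ball (x0 : V) (N : nat) : {fset V} :=
  fset_set (\bigcup_(i in `I_N.+1) graph_sphere x0 i).

Record cayley_tree (k : nat) : Prop := CayleyTree {
  cayley_sym : symmetric e ;
  cayley_irr : irreflexive e ;
  cayley_degree : forall x, exists s : seq V,
    [/\ uniq s, size s = k.+1 & s =i e x] ;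
  cayley_connected : forall x y, exists m, walk x y m ;
  cayley_acyclic : forall c : seq V, (2 < size c)%N -> ~ ucycle e c ;
  cayley_infinite : infinite_set [set: V] }.

End graph.

Section model.
Variable R : realType.

Definition odd_root (n : nat) (x : R) : R :=
  Num.sg x * `|x| `^ ((n.*2.+1)%:R^-1).

Lemma odd_rootK n x : odd_root n x ^+ n.*2.+1 = x.
Proof.
rewrite /odd_root exprMn -(powR_mulrn _ (powR_ge0 _ _)) -powRrM.
rewrite mulVf ?pnatr_eq0// powRr1// exprS -mul2n exprM sqr_sg.
have [->|x0] := eqVneq x 0; first by rewrite sgr0 !mul0r.
by rewrite expr1n mulr1 -numEsg.
Qed.

Definition xi (n : nat) (theta t u : R) : R :=
  ln (1 + theta * odd_root n (4 * (t - 2^-1) * (u - 2^-1))).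

Definition boltzmann (beta : R) (xi : R -> R -> R) (t u : R) : R :=
  expR (beta * xi t u).

Definition hammerstein (k : nat) (K : R -> R -> R) (f : R -> R) (t : R) : R :=
  \int[lebesgue_measure]_(u in `[0, 1]) (K t u * f u ^+ k).

(* elements of C[0,1] are represented by functions on R, of which only the
   restriction to [0,1] matters *)
Definition positive_fixed_point (k : nat) (K : R -> R -> R) (f : R -> R) : Prop :=
  [/\ {within `[0, 1], continuous f},
      (forall t : R, t \in `[0, 1] -> 0 < f t) &
      (forall t : R, t \in `[0, 1] -> hammerstein k K f t = f t)].

Section gibbs.
Context (V : choiceType) (e : rel V) (x0 : V).

Definition edges (A : {fset V}) : {set {set A}} :=
  [set a : {set A} | [exists x : A, [exists y : A,
     e (val x) (val y) && (a == [set x; y]%SET)]]]%SET.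

(* K (s x) (s y) for the unordered pair a = {x, y}; the order of x and y is
   immaterial when K is symmetric *)
Definition edge_weight (K : R -> R -> R) (A : {fset V})
    (s : config A (spin R)) (a : {set A}) : R :=
  if enum a is [:: x; y] then K (spin_val (s x)) (spin_val (s y)) else 1.

Definition gibbs_weight (k : nat) (K : R -> R -> R) (f : R -> R) (N : nat)
    (s : config (graph_ball e x0 N) (spin R)) : R :=
  (\prod_(a in edges (graph_ball e x0 N)) edge_weight K s a) *
  \prod_(x : graph_ball e x0 N | val x \in graph_sphere e x0 N)
    f (spin_val (s x)) ^+ k.

Definition partition_function (k : nat) (K : R -> R -> R) (f : R -> R)
    (N : nat) : R :=
  \int[product_probability (@spin_lebesgue R) (graph_ball e x0 N)]_s
    gibbs_weight k K f s.

Definition restriction (A : {fset V}) (sigma : config V (spin R)) :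
  config A (spin R) := fun x => sigma (val x).

(* splitting Gibbs measure on the tree e of order k, for the Hamiltonian
   - \sum_<x,y> xi (sigma x) (sigma y) at inverse temperature beta *)
Definition ti_splitting_gibbs_measure (k : nat) (beta : R) (xi : R -> R -> R)
    (mu : probability (config V (spin R)) R) : Prop :=
  let K := boltzmann beta xi in
  exists2 f : R -> R, positive_fixed_point k K f &
    forall N : nat, (1 <= N)%N ->
    forall B : set (config (graph_ball e x0 N) (spin R)), measurable B ->
      pushforward mu (@restriction (graph_ball e x0 N)) B =
      (\int[product_probability (@spin_lebesgue R) (graph_ball e x0 N)]_(s in B)
        ((partition_function k K f N)^-1 * gibbs_weight k K f s)%:E)%E.

End gibbs.
End model.

(* There are exactly m measures satisfying Q. They are counted up to equality
   on measurable sets, since the values of a measure of the library outside the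
   sigma-algebra are unconstrained. *)
Definition exactly_probabilities d (T : measurableType d) (R : realType)
    (m : nat) (Q : probability T R -> Prop) : Prop :=
  exists mu : 'I_m -> probability T R,
    [/\ (forall i, Q (mu i)),
        (forall i j, measure_eq (mu i) (mu j) -> i = j) &
        (forall nu, Q nu -> exists i, measure_eq nu (mu i))].

(* Main.v *)
Require Import Defs.
From HB Require Import structures.
From mathcomp Require Import all_boot all_order all_algebra finmap.
From mathcomp Require Import all_classical all_reals all_analysis.
From mathcomp Require Import measurable_realfun giry.
From mathcomp Require Import ring lra zify.
Set Implicit Arguments.
Unset Strict Implicit.
Unset Printing Implicit Defensive.
Import Order.TTheory GRing.Theory Num.Theory.
Import numFieldNormedType.Exports.
Local Open Scope classical_set_scope.
Local Open Scope ring_scope.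

(** Write phi(u) for the odd root of 2u - 1. The odd root is multiplicative, so
the Boltzmann factor is 1 + theta phi(t) phi(u), a kernel of rank two, and a
positive fixed point of H_k has the form c (1 + x phi) with c > 0; its
positivity at the endpoints, where phi is -1 and 1, means -1 < x < 1. The fixed
point equation splits into two scalar equations: the integral of
c^(k-1) (1 + x phi)^k is 1, which determines c from x ([amplitude]), and
theta times the integral of phi (1 + x phi)^k is x times the integral of
(1 + x phi)^k. The moments of phi are explicit, the odd ones vanish, and
expanding the powers turns the second equation into x S(x) = 0 for an even
polynomial S ([bif_equation]). The signs of the coefficients of S change at
most once ([bif_coef_sign]), S(1) > 0 because theta < 1, and
S(0) = 1 - theta / theta_c. By Descartes' rule S has no root in ]0, 1[ when
theta <= theta_c, and exactly one, r, when theta > theta_c. The solutions are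
therefore 0 alone, or 0, r and -r.

It remains to see that these solutions correspond bijectively to measures.

Existence. Rooting the tree at x0, the edges of a ball correspond to its
vertices other than x0, each paired with its parent, so that the weight of a
configuration on a ball factorizes along the generations. By the fixed point
equation, integrating out one vertex y of the last generation replaces its
factors by f at the parent of y, and each parent collects one factor f per
child: the weights of successive balls are consistent
([resample_tree_density]). Consistent positive densities on an increasing
sequence of finite sets always extend to a probability measure
([consistent_densities_extension]); this holds over an arbitrary measurable
spin space. The extension is Caratheodory's, and continuity at the empty set is
obtained as in the Ionescu-Tulcea theorem, by choosing the coordinates of a
common point of the cylinders one block after another
([cylinders_common_point]).

Uniqueness. The cylinder sets form a pi-system, so the marginals on balls
determine the measure ([marginals_measure_eq]).

Injectivity. The spin at the root has density proportional to f^(k+1). If two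
profiles c (1 + x phi) and c' (1 + x' phi) give the same law of this spin, they
are proportional almost everywhere, hence at two points where phi differs, and
this forces x = x' ([tree_gibbs_injective]). *)

(** * Products of independent coordinates *)
Section product_integral.
Context d (T : measurableType d) (R : realType) (P : probability T R).

Lemma measurable_prod_comp (I : eqType) d' (S : measurableType d') (r : seq I)
    (h : I -> T -> R) (X : I -> S -> T) :
  (forall i, measurable_fun setT (h i)) ->
  (forall i, measurable_fun setT (X i)) ->
  measurable_fun setT (fun s => \prod_(i <- r) h i (X i s)).
Proof.
by move=> mh mX; apply: measurable_prod => i _; exact: measurableT_comp.
Qed.

Lemma integral_tuple_prod n (h : 'I_n -> T -> R) :
    (forall i, measurable_fun setT (h i)) -> (forall i x, 0 <= h i x) ->
  (\int[tuple_probability P n]_t (\prod_i h i (tnth t i))%:E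
    = \prod_i \int[P]_x (h i x)%:E)%E.
Proof.
elim: n h => [|n IH] h mh h0.
  rewrite big_ord0 /=; under eq_integral do rewrite big_ord0.
  by rewrite integral_cst// mul1e; exact: diracT.
have mp : measurable_fun setT
    (EFin \o (fun t : n.+1.-tuple T => \prod_i h i (tnth t i))).
  apply/measurable_EFinP; apply: measurable_prod_comp => // i.
  exact: measurable_tnth.
rewrite /= ge0_integral_distribution//=; last first.
  by move=> t; rewrite lee_fin prodr_ge0.
rewrite fubini_tonelli1; last 2 first.
- apply: (measurableT_comp mp).
  exact: (@measurable_cons _ _ _ _ fst _ snd).
- by move=> x /=; rewrite lee_fin prodr_ge0.
rewrite big_ord_recl /fubini_F /=.
transitivity (\int[P]_x ((h ord0 x)%:E *
   \prod_(i < n) \int[P]_x (h (lift ord0 i) x)%:E)%E)%E.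
  apply: eq_integral => x _ /=.
  rewrite -IH//; rewrite -ge0_integralZl//; last 3 first.
  - apply/measurable_EFinP.
    apply: (@measurable_prod_comp _ _ _ _ (fun i => h (lift ord0 i))) => // i.
    exact: measurable_tnth.
  - by move=> t _; rewrite lee_fin prodr_ge0.
  - by rewrite lee_fin.
  apply: eq_integral => t _.
  rewrite big_ord_recl tnth0 EFinM; congr (_ * _%:E)%E.
  by apply: eq_bigr => i _; rewrite tnthS.
rewrite ge0_integralZr//; first exact/measurable_EFinP.
- by move=> x _; rewrite lee_fin.
- by rewrite prode_ge0// => i _; apply: integral_ge0 => x _; rewrite lee_fin.
Qed.

Lemma integral_product_prod (I : finType) (h : I -> T -> R) :
    (forall i, measurable_fun setT (h i)) -> (forall i x, 0 <= h i x) ->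
  (\int[product_probability P I]_s (\prod_i h i (s i))%:E
    = \prod_i \int[P]_x (h i x)%:E)%E.
Proof.
move=> mh h0; rewrite /product_probability ge0_integral_distribution//=; last 2 first.
- apply/measurable_EFinP; apply: measurable_prod_comp => // i.
  exact: measurable_coord.
- by move=> s; rewrite lee_fin prodr_ge0.
have enum_bij : {on [pred i : I | true], bijective (@enum_val I predT)}.
  by exists enum_rank => i _; rewrite ?enum_valK ?enum_rankK.
transitivity (\int[tuple_probability P #|I|]_t
    (\prod_(i < #|I|) h (enum_val i) (tnth t i))%:E)%E.
  apply: eq_integral => t _; congr (_%:E).
  by rewrite /= (reindex _ enum_bij)/=; apply: eq_bigr => i _; rewrite enum_valK.
rewrite (@integral_tuple_prod _ (fun i => h (enum_val i)))//.
by rewrite [RHS](reindex _ enum_bij).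
Qed.

End product_integral.

Section box.
Context (V : choiceType) d (T : measurableType d) (R : realType).

Definition box (r : seq V) (B : V -> set T) : set (config V T) :=
  [set s | forall v, v \in r -> B v (s v)].

Lemma measurable_box r B : (forall v, measurable (B v)) -> measurable (box r B).
Proof.
move=> mB; have -> : box r B = \bigcap_(v in [set` r]) ((fun s : config V T => s v) @^-1` B v).
  by apply/seteqP; split.
apply: fin_bigcap_measurable => [|v _]; first exact: finite_seq.
by rewrite -[X in measurable X]setTI; exact: (measurable_coord v measurableT).
Qed.

(** Boxes with finitely many constrained coordinates form a pi-system that
generates the sigma-algebra of the configuration space. *)
Lemma config_measure_eq (m1 m2 : probability (config V T) R) :
  (forall r B, uniq r -> (forall v, measurable (B v)) -> m1 (box r B) = m2 (box r B)) ->
  forall D, measurable D -> m1 D = m2 D.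
Proof.
move=> m12; pose G := [set D | exists r B,
  [/\ uniq r, (forall v, measurable (B v)) & D = box r B]].
have GT : G setT.
  by exists [::], (fun=> setT); split => //; apply/seteqP; split.
have GI : setI_closed G.
  move=> _ _ [r1 [B1 [u1 mB1 ->]]] [r2 [B2 [u2 mB2 ->]]].
  exists (undup (r1 ++ r2)), (fun v => (if v \in r1 then B1 v else setT) `&`
                               (if v \in r2 then B2 v else setT)); split.
  - exact: undup_uniq.
  - by move=> v; apply: measurableI; case: ifP.
  - apply/seteqP; split => [s [s1 s2] v _|s s12].
      by split; case: ifPn => // vr; [exact: s1|exact: s2].
    split => v vr; have := s12 v; rewrite mem_undup mem_cat vr ?orbT => /(_ erefl);
      by rewrite -?vr; case.
apply: (measure_unique G (fun=> setT)) => //.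
- apply/seteqP; split => D.
    move=> mD; apply: (mD <<s G >>); split; first exact: smallest_sigma_algebra.
    move=> _ [v _ [B mB <-]]; apply: sub_sigma_algebra.
    exists [:: v], (fun=> B); split => //; rewrite setTI.
    by apply/seteqP; split => [s Bs w /[!inE]/eqP->//|s]; apply; rewrite inE.
  apply: smallest_sub; first exact: sigma_algebra_measurable.
  by move=> _ [r [B [_ mB ->]]]; exact: measurable_box.
- by rewrite bigcup_const.
- by move=> _ [r [B [ur mB ->]]]; exact: m12.
- by move=> _; rewrite [X in (X < _)%E](@probability_setT _ _ _ m1) ltry.
Qed.

Lemma indic_box r (B : V -> set T) s :
  \1_(box r B) s = \prod_(v <- r) \1_(B v) (s v) :> R.
Proof.
rewrite indicE; case: (pselect (box r B s)) => [sB|nsB].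
  rewrite mem_set// big_seq big1// => v vr; rewrite indicE mem_set//; exact: sB.
rewrite memNset//; have [v vr nB] : exists2 v, v \in r & ~ B v (s v).
  by move: nsB => /existsNP[v /not_implyP[? ?]]; exists v.
apply/esym/eqP; rewrite prodf_seq_eq0; apply/hasP; exists v => //=.
by rewrite indicE memNset.
Qed.

End box.

Section partial_product.
Context (V : choiceType) d (T : measurableType d) (R : realType).
Variable P : probability T R.
Implicit Types A B : {fset V}.

(** Embedding the configurations on a finite set into those on V, with a fixed
spin outside, puts all finite products on one space; no cast between
configuration spaces of different finite sets is then needed. *)
Definition extend A (s : config A T) : config V T :=
  fun v => if insub v is Some a then s a else point.

Lemma measurable_extend A : measurable_fun setT (@extend A).
Proof.
apply: measurable_configP => v; rewrite /extend.
by case: insub => [a|]; [exact: measurable_coord|exact: measurable_cst].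
Qed.

HB.instance Definition _ A :=
  isMeasurableFun.Build _ _ _ _ (@extend A) (@measurable_extend A).

Definition partial_product A : probability (config V T) R :=
  distribution (product_probability P A) (@extend A).

Lemma big_seq_fset A (r : seq V) (S : Type) (idx : S) (op : Monoid.com_law idx)
    (F : V -> S) : uniq r ->
  \big[op/idx]_(v <- r | v \in A) F v =
  \big[op/idx]_(a : A) if val a \in r then F (val a) else idx.
Proof.
move=> ur; rewrite -(big_seq_fsetE _ _ predT (fun v => if v \in r then F v else idx))/=.
rewrite -big_mkcond -big_filter -[RHS]big_filter; apply: perm_big.
apply: uniq_perm; rewrite ?filter_uniq// => v.
by rewrite !mem_filter andbC.
Qed.

(** Under [partial_product A] all coordinates are independent: those in A have
law P and the others are Dirac masses. *)
Lemma integral_partial_product A (r : seq V) (h : V -> T -> R) : uniq r ->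
    (forall v, measurable_fun setT (h v)) -> (forall v x, 0 <= h v x) ->
  (\int[partial_product A]_s (\prod_(v <- r) h v (s v))%:E =
   \prod_(v <- r) if v \in A then \int[P]_x (h v x)%:E else (h v point)%:E)%E.
Proof.
move=> ur mh h0; rewrite /partial_product ge0_integral_distribution//; last 2 first.
- by apply/measurable_EFinP; apply: measurable_prod_comp => // v; exact: measurable_coord.
- by move=> s; rewrite lee_fin prodr_ge0.
pose g (a : A) x := if val a \in r then h (val a) x else 1.
pose c := \prod_(v <- r | v \notin A) h v point.
have c0 : 0 <= c by rewrite prodr_ge0.
transitivity (\int[product_probability P A]_s (c%:E * (\prod_(a : A) g a (s a))%:E))%E.
  apply: eq_integral => s _; rewrite /= -EFinM mulrC; congr (_%:E).
  rewrite (bigID [in A])/= big_seq_fset// /g /=; congr (_ * _).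
    apply: eq_bigr => a _; case: ifP => // _; congr (h _ _).
    by rewrite /extend insubT ?fsvalP// => Aa; congr s; exact: val_inj.
  apply: eq_bigr => v vA; congr (h _ _).
  by rewrite /extend insubF//; exact: negbTE.
have mg a : measurable_fun setT (g a).
  by rewrite /g; case: (val a \in r) => //; exact: measurable_cst.
have g0 a x : 0 <= g a x by rewrite /g; case: (val a \in r).
rewrite ge0_integralZl//; last 2 first.
- by apply/measurable_EFinP; apply: measurable_prod_comp => // a; exact: measurable_coord.
- by move=> s _; rewrite lee_fin prodr_ge0.
rewrite integral_product_prod// [RHS](bigID [in A])/= muleC; congr (_ * _)%E.
  under [RHS]eq_bigr => v -> do [].
  rewrite big_seq_fset//; apply: eq_bigr => a _; rewrite /g; case: ifP => // _.
  by rewrite integral_cst// mul1e; exact: probability_setT.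
rewrite /c -prodEFin; apply: eq_bigr => v vA.
by rewrite (negbTE vA).
Qed.

Lemma partial_product_box A r (B : V -> set T) : uniq r ->
    (forall v, measurable (B v)) ->
  (partial_product A (box r B) =
   \prod_(v <- r) if v \in A then P (B v) else (\1_(B v) (point : T))%:E)%E.
Proof.
move=> ur mB.
have <- : (\int[partial_product A]_s (\1_(box r B) s)%:E)%E = partial_product A (box r B).
  by rewrite integral_indic ?setIT//; exact: measurable_box.
under eq_integral do rewrite indic_box.
rewrite (integral_partial_product _ (h := fun v => \1_(B v)))//.
apply: eq_bigr => v _; case: ifP => // _.
by rewrite integral_indic// setIT.
Qed.

(** The first argument of [splice A] is kept on A and the second is used off A,
so integrating over the second resamples the coordinates outside A. *)
Definition splice A (st : config V T * config V T) : config V T :=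
  fun v => if v \in A then st.1 v else st.2 v.

Lemma measurable_splice A : measurable_fun setT (splice A).
Proof.
apply: measurable_configP => v; rewrite /splice; case: (v \in A).
  by apply: (measurableT_comp (measurable_coord v)); exact: measurable_fst.
by apply: (measurableT_comp (measurable_coord v)); exact: measurable_snd.
Qed.

HB.instance Definition _ A :=
  isMeasurableFun.Build _ _ _ _ (@splice A) (@measurable_splice A).

(** The splice of independent samples over A and over B is a sample over B. *)
Lemma integral_splice A B (h : config V T -> \bar R) : (A `<=` B)%fset ->
    measurable_fun setT h -> (forall s, 0 <= h s)%E ->
  (\int[partial_product A]_s \int[partial_product B]_t h (splice A (s, t)) =
   \int[partial_product B]_t h t)%E.
Proof.
move=> AB mh h0.
pose m : probability (config V T) R :=
  distribution (partial_product A \x partial_product B)%E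
    (splice A).
have mE D : measurable D -> partial_product B D = m D.
  apply: config_measure_eq => r C ur mC.
  have pre : splice A @^-1` box r C =
      box [seq v <- r | v \in A] C `*` box [seq v <- r | v \notin A] C.
    apply/seteqP; split => [[s t] st|[s t] [/= sC tC] v vr].
      by split => v; rewrite mem_filter => /andP[vA /st]; rewrite /splice ?vA ?(negbTE vA).
    by rewrite /splice/=; case: ifPn => vA; [apply: sC|apply: tC]; rewrite mem_filter vA.
  rewrite partial_product_box//; symmetry.
  transitivity (partial_product A (box [seq v <- r | v \in A] C) *
      partial_product B (box [seq v <- r | v \notin A] C))%E.
    by rewrite -product_measure1E; [rewrite -pre|exact: measurable_box..].
  rewrite !partial_product_box ?filter_uniq// !big_filter.
  rewrite [RHS](bigID [in A])/=; congr (_ * _)%E; apply: eq_bigr => v vA.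
    by rewrite vA (fsubsetP AB).
rewrite [RHS](eq_measure_integral m); last by move=> D mD _; exact: mE.
rewrite /m [RHS]ge0_integral_distribution; [symmetry|exact: mh|exact: h0].
apply: (fubini_tonelli1 (h \o splice A)) => [|z]; last exact: h0.
by apply: measurableT_comp => //; exact: measurable_splice.
Qed.

End partial_product.

(** * Extension of consistent densities *)
Lemma integral_cst_probability d (T : measurableType d) (R : realType)
  (P : probability T R) (c : \bar R) : (\int[P]_x cst c x = c)%E.
Proof.
rewrite integral_cst// [X in (_ * X)%E](_ : _ = 1%E) ?mule1//.
exact: probability_setT.
Qed.

Lemma lt_integral_probability d (T : measurableType d) (R : realType)
    (P : probability T R) (f g : T -> \bar R) :
    measurable_fun setT f -> measurable_fun setT g ->
    (forall x, 0 <= f x)%E -> (forall x, f x < g x)%E ->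
    (\int[P]_x g x < +oo)%E ->
  (\int[P]_x f x < \int[P]_x g x)%E.
Proof.
move=> mf mg f0 fg goo; rewrite ltNge; apply/negP => gf.
have ffin x : f x \is a fin_num.
  by rewrite ge0_fin_numE// (lt_le_trans (fg x))// leey.
have gf0 x : (0 <= g x - f x)%E by rewrite sube_ge0 ?ffin// ltW.
have mgf : measurable_fun setT (fun x => g x - f x)%E by exact: emeasurable_funB.
have gE : (\int[P]_x g x = \int[P]_x f x + \int[P]_x (g x - f x))%E.
  rewrite -ge0_integralD//; apply: eq_integral => x _.
  by rewrite addeC subeK.
have If0 : (0 <= \int[P]_x f x)%E by exact: integral_ge0.
have Igf0 : (0 <= \int[P]_x (g x - f x))%E by exact: integral_ge0.
have Iffin : (\int[P]_x f x)%E \is a fin_num.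
  rewrite ge0_fin_numE// (le_lt_trans _ goo)//.
  by apply: ge0_le_integral => // x _; exact: ltW.
have I0 : (\int[P]_x (g x - f x) = 0)%E.
  apply/eqP; rewrite eq_le Igf0 andbT.
  by move: gf; rewrite gE -[leRHS]adde0 leeD2lE.
have : ae_eq P setT (fun x => g x - f x)%E (cst 0%E).
  apply/ae_eq_integral_abs => //; rewrite -[RHS]I0; apply: eq_integral => x _.
  by rewrite gee0_abs.
case=> N [mN PN0 sN]; have : N = setT.
  apply/seteqP; split => // x _; apply: sN => /(_ I)/= gfx.
  by have := fg x; rewrite -sube_gt0 gfx ltxx.
move=> NT; have := probability_setT P; rewrite -NT => PN1.
by move: PN0; rewrite [LHS]PN1 => /eqP; rewrite onee_eq0.
Qed.

Section cylinder_algebra.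
Context (V : choiceType) d (T : measurableType d).

Definition determined (F : {fset V}) (D : set (config V T)) :=
  forall s s', {in F, s =1 s'} -> D s -> D s'.

Definition finitely_determined D := exists F, determined F D.

Lemma determined_sub (F F' : {fset V}) D : (F `<=` F')%fset ->
  determined F D -> determined F' D.
Proof. by move=> FF' dD s s' ss'; apply: dD => v /(fsubsetP FF'); exact: ss'. Qed.

Definition cylinder_sets : set (set (config V T)) :=
  [set D | measurable D /\ finitely_determined D].

(** A copy of the configuration space that carries the algebra of cylinder sets
in place of the sigma-algebra, as Caratheodory's extension starts from an
algebra. *)
Definition cylinder_config : Type := config V T.

HB.instance Definition _ := Pointed.on cylinder_config.

Let cylinder_sets0 : cylinder_sets set0.
Proof. by split => //; exists fset0. Qed.

Let cylinder_setsU : setU_closed cylinder_sets.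
Proof.
move=> D D' [mD [F dD]] [mD' [F' dD']]; split; first exact: measurableU.
exists (F `|` F')%fset => s s' ss' [Ds|D's]; [left|right].
  by apply: dD Ds => v vF; apply: ss'; rewrite inE vF.
by apply: dD' D's => v vF; apply: ss'; rewrite inE vF orbT.
Qed.

Let cylinder_setsC : setC_closed cylinder_sets.
Proof.
move=> D [mD [F dD]]; split; first exact: measurableC.
by exists F => s s' ss' nDs D's; apply/nDs/(dD s') => // v /ss'.
Qed.

Definition cylinder_display : measure_display := sigma_display cylinder_sets.

HB.instance Definition _ := @isAlgebraOfSets.Build cylinder_display
  cylinder_config cylinder_sets cylinder_sets0 cylinder_setsU cylinder_setsC.

Lemma cylinder_sets_generate : <<s cylinder_sets >> = measurable.
Proof.
apply/seteqP; split.
  by apply: smallest_sub; [exact: sigma_algebra_measurable|move=> D []].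
move=> D mD; apply: (mD <<s cylinder_sets >>); split.
  exact: smallest_sigma_algebra.
move=> _ [v _ [B mB <-]]; apply: sub_sigma_algebra; split.
  by apply: sub_sigma_algebra; exists v => //; exists B.
exists [fset v]%fset => s s' ss' [_ Bs]; split => //=.
by rewrite -ss'// inE.
Qed.

End cylinder_algebra.

Section consistent_densities.
Context (V : choiceType) d (T : measurableType d) (R : realType).
Variables (P : probability T R) (A : nat -> {fset V}) (W : nat -> config V T -> R).
Local Notation Om := (config V T).
Local Notation PA N := (partial_product P (A N)).
Implicit Types D : set Om.

(** For each N, [resample N h s] keeps the coordinates of s in A N and averages
h over fresh independent coordinates in the next block. *)
Definition resample N (h : Om -> \bar R) (s : Om) : \bar R :=
  (\int[PA N.+1]_t h (splice (A N) (s, t)))%E.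

Fixpoint resamples j N h : Om -> \bar R :=
  if j is j'.+1 then resample N (resamples j' N.+1 h) else h.

Definition restricted_density (D : set Om) M (s : Om) : \bar R :=
  (W M s * \1_D s)%:E.

Definition level (D : set Om) : nat := xget 0%N [set N | determined (A N) D].

(** W N s times the conditional probability of D given the coordinates of s in
A N. The block at which the iteration stops is irrelevant once it is beyond the
level of D, see [conditional_massE]. *)
Definition conditional_mass (D : set Om) N : Om -> \bar R :=
  resamples (maxn N (level D) - N) N
    (restricted_density D (maxn N (level D))).

Hypothesis A0 : A 0%N = fset0.
Hypothesis subA : forall N, (A N `<=` A N.+1)%fset.
Hypothesis coverA : forall v, exists N, v \in A N.
Hypothesis mW : forall N, measurable_fun setT (W N).
Hypothesis W_gt0 : forall N s, 0 < W N s.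
Hypothesis W0 : forall s, W 0%N s = 1.
Hypothesis resample_W :
  forall N s, resample N (EFin \o W N.+1) s = (W N s)%:E.

Lemma splice_in (B : {fset V}) (s t : Om) : {in B, splice B (s, t) =1 s}.
Proof. by move=> v vB; rewrite /splice vB. Qed.

Lemma subA_le N M : (N <= M)%N -> (A N `<=` A M)%fset.
Proof.
move=> /subnK <-; elim: (M - N)%N => // j IH.
by rewrite addSn; exact: fsubset_trans IH (subA _).
Qed.

Lemma indic_determined F (D : set Om) s s' : determined F D -> {in F, s =1 s'} ->
  \1_D s = \1_D s' :> R.
Proof.
move=> dD ss'; rewrite !indicE; congr (_%:R); congr nat_of_bool.
apply/idP/idP => /set_mem Ds; apply/mem_set; first exact: (dD s).
by apply: (dD s') => // v /ss'.
Qed.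

Lemma measurable_section_splice (h : Om -> \bar R) N s : measurable_fun setT h ->
  measurable_fun setT (fun t => h (splice (A N) (s, t))).
Proof.
move=> mh; apply: (measurableT_comp mh).
exact: (measurableT_comp (measurable_splice (A N)) (measurable_pair1 s)).
Qed.

Lemma measurable_resample N h : measurable_fun setT h -> (forall s, 0 <= h s)%E ->
  measurable_fun setT (resample N h).
Proof.
move=> mh h0.
apply: (measurable_fun_fubini_tonelli_F (h \o splice (A N))) => [|x]; last exact: h0.
by apply: measurableT_comp => //; exact: measurable_splice.
Qed.

Lemma resample_ge0 N h s : (forall s, 0 <= h s)%E -> (0 <= resample N h s)%E.
Proof. by move=> h0; apply: integral_ge0 => t _; exact: h0. Qed.

Lemma resamples_ge0 j N h s : (forall s, 0 <= h s)%E -> (0 <= resamples j N h s)%E.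
Proof.
by move=> h0; elim: j N s => [//|j IH] N s /=; apply: resample_ge0 => t; exact: IH.
Qed.

Lemma measurable_resamples j N h : measurable_fun setT h -> (forall s, 0 <= h s)%E ->
  measurable_fun setT (resamples j N h).
Proof.
move=> mh h0; elim: j N => [//|j IH] N /=.
by apply: measurable_resample => // s; exact: resamples_ge0.
Qed.

Lemma eq_resample N h s s' : {in A N, s =1 s'} -> resample N h s = resample N h s'.
Proof.
move=> ss'; apply: eq_integral => t _; congr h.
by apply/funext => v; rewrite /splice/=; case: ifP => // /ss'.
Qed.

Lemma resamplesSr j N h :
  resamples j.+1 N h = resamples j N (resample (j + N)%N h).
Proof.
elim: j N h => [//|j IH] N h.
by rewrite [LHS]/= -/(resamples j.+1 N.+1 h) IH addSnnS.
Qed.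

Lemma le_resamples j N h g : measurable_fun setT h -> (forall s, 0 <= h s)%E ->
    measurable_fun setT g -> (forall s, h s <= g s)%E ->
  forall s, (resamples j N h s <= resamples j N g s)%E.
Proof.
move=> mh h0 mg hg; elim: j N => [//|j IH] N s /=.
have g0 t : (0 <= g t)%E by exact: le_trans (hg t).
apply: ge0_le_integral => // [t _||].
- exact: resamples_ge0.
- by apply: measurable_section_splice; exact: measurable_resamples.
- by apply: measurable_section_splice; exact: measurable_resamples.
Qed.

Lemma measurable_restricted_density D M : measurable D ->
  measurable_fun setT (restricted_density D M).
Proof.
move=> mD; apply/measurable_EFinP; apply: measurable_funM; first exact: mW.
exact: measurable_indic.
Qed.

Lemma restricted_density_ge0 D M s : (0 <= restricted_density D M s)%E.
Proof. by rewrite lee_fin mulr_ge0// ltW. Qed.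

Lemma integral_restricted_density D M : measurable D ->
  (\int[PA M]_s restricted_density D M s = \int[PA M]_(s in D) (W M s)%:E)%E.
Proof.
move=> mD; rewrite [RHS]integral_mkcond; apply: eq_integral => s _.
by rewrite epatch_indic.
Qed.

Lemma resample_restricted_density D N : determined (A N) D -> measurable D ->
  resample N (restricted_density D N.+1) = restricted_density D N.
Proof.
move=> dD mD; apply/funext => s; rewrite /resample /restricted_density.
under eq_integral => t _.
  rewrite (indic_determined (s' := s) dD); last exact: splice_in.
  rewrite mulrC EFinM; over.
rewrite ge0_integralZl//.
- by rewrite -/(resample N (EFin \o W N.+1) s) resample_W -EFinM mulrC.
- apply: (@measurable_section_splice (EFin \o W N.+1)); exact/measurable_EFinP.
- by move=> t _; rewrite lee_fin ltW.
Qed.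

(** Consistency of the densities: averaging over a block on which D does not
depend changes nothing. *)
Lemma resamples_stable D N i j : measurable D -> determined (A (j + N)) D ->
  resamples (i + j) N (restricted_density D (i + j + N)) =
  resamples j N (restricted_density D (j + N)).
Proof.
move=> mD dD; elim: i => [//|i IH]; rewrite addSn resamplesSr addSn.
rewrite resample_restricted_density//.
by apply: determined_sub dD; apply: subA_le; rewrite -addnA leq_addl.
Qed.

Lemma finitely_determinedP D : finitely_determined D -> exists N, determined (A N) D.
Proof.
move=> [F dD]; have /choice[lev levP] := coverA.
exists (\max_(v <- F) lev v); apply: determined_sub dD.
apply/fsubsetP => v vF; apply: (fsubsetP (subA_le _)) (levP v).
exact: leq_bigmax_seq.
Qed.

Lemma levelP D : finitely_determined D -> determined (A (level D)) D.
Proof.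
move=> /finitely_determinedP[N dN].
by apply: (@xgetPex _ 0%N [set N | determined (A N) D]); exists N.
Qed.

Lemma conditional_massE D N j : measurable D -> determined (A (j + N)) D ->
  conditional_mass D N = resamples j N (restricted_density D (j + N)).
Proof.
move=> mD dD; rewrite /conditional_mass.
have fD : finitely_determined D by exists (A (j + N)).
set M := maxn N (level D); set i := (M - N)%N.
have ME : M = (i + N)%N by rewrite subnK// leq_maxl.
have dM : determined (A (i + N)) D.
  by rewrite -ME; apply: determined_sub (levelP fD); apply/subA_le/leq_maxr.
rewrite ME; case: (leqP i j) => [|/ltnW] ij.
  by rewrite -(subnK ij) resamples_stable.
by rewrite -(subnK ij) resamples_stable.
Qed.

Lemma determined_level D N : finitely_determined D ->
  exists j, determined (A (j + N)) D.
Proof.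
move=> /levelP dD; exists (level D); apply: determined_sub dD.
by apply: subA_le; rewrite leq_addr.
Qed.

Lemma conditional_mass_step D N : measurable D -> finitely_determined D ->
  conditional_mass D N = resample N (conditional_mass D N.+1).
Proof.
move=> mD fD; have [j dD] := determined_level N.+1 fD.
rewrite (conditional_massE mD dD) (conditional_massE (j := j.+1) (N := N))//=.
  by rewrite addSnnS.
by rewrite addSnnS.
Qed.

Lemma measurable_conditional_mass D N : measurable D ->
  measurable_fun setT (conditional_mass D N).
Proof.
move=> mD; apply: measurable_resamples => [|s].
- exact: measurable_restricted_density.
- exact: restricted_density_ge0.
Qed.

Lemma conditional_mass_ge0 D N s : (0 <= conditional_mass D N s)%E.
Proof. by apply: resamples_ge0 => t; exact: restricted_density_ge0. Qed.

Lemma le_conditional_mass D D' N s : measurable D -> finitely_determined D ->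
    measurable D' -> finitely_determined D' -> D `<=` D' ->
  (conditional_mass D N s <= conditional_mass D' N s)%E.
Proof.
move=> mD fD mD' fD' DD'.
have [j dD] := determined_level N fD; have [j' dD'] := determined_level N fD'.
rewrite (@conditional_massE _ _ (j + j'))//; last first.
  by apply: determined_sub dD; apply: subA_le; rewrite leq_add2r leq_addr.
rewrite (@conditional_massE D' _ (j + j'))//; last first.
  by apply: determined_sub dD'; apply: subA_le; rewrite leq_add2r leq_addl.
apply: le_resamples => [|t||t].
- exact: measurable_restricted_density.
- exact: restricted_density_ge0.
- exact: measurable_restricted_density.
- rewrite lee_fin; apply: ler_wpM2l; first exact: ltW.
  rewrite !indicE.
  by case: (boolP (t \in D)) => [/set_mem/DD'/mem_set ->|_]; rewrite ?lexx ?ler0n.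
Qed.

Lemma conditional_mass_determined D N : measurable D -> determined (A N) D ->
  conditional_mass D N = restricted_density D N.
Proof. by move=> mD dD; rewrite (@conditional_massE _ _ 0). Qed.

Lemma conditional_mass_le D N s : measurable D -> finitely_determined D ->
  (conditional_mass D N s <= (W N s)%:E)%E.
Proof.
move=> mD fD.
have dT F : determined F setT by [].
apply: (le_trans (le_conditional_mass (D' := setT) N s mD fD _ _ _)) => //.
  by exists fset0.
by rewrite conditional_mass_determined// lee_fin indicT mulr1.
Qed.

Lemma eq_conditional_mass D N s s' : measurable D -> finitely_determined D ->
  {in A N, s =1 s'} -> conditional_mass D N s = conditional_mass D N s'.
Proof. by move=> mD fD ss'; rewrite conditional_mass_step//; exact: eq_resample. Qed.

(** As A 0 is empty, the base point is immaterial. *)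
Definition cylinder_mass D := conditional_mass D 0 point.

Lemma cylinder_massE D N : measurable D -> determined (A N) D ->
  cylinder_mass D = (\int[PA N]_(s in D) (W N s)%:E)%E.
Proof.
move=> mD dD; have fD : finitely_determined D by exists (A N).
rewrite -integral_restricted_density// -conditional_mass_determined//.
transitivity (\int[PA 0]_s conditional_mass D 0 s)%E.
  transitivity (\int[PA 0]_s cst (cylinder_mass D) s)%E.
    by rewrite integral_cst_probability.
  apply: eq_integral => s _; apply: eq_conditional_mass => // v.
  by rewrite A0.
elim: N {dD} => // N ->.
rewrite -(@integral_splice _ _ _ _ P _ _ _ (subA N)).
- by apply: eq_integral => s _; rewrite conditional_mass_step.
- exact: measurable_conditional_mass.
- by move=> s; exact: conditional_mass_ge0.
Qed.

Section path_of_cylinders.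
Variables (D : nat -> set Om) (c : R).
Hypothesis mD : forall j, measurable (D j).
Hypothesis fD : forall j, finitely_determined (D j).
Hypothesis decrD : forall j, D j.+1 `<=` D j.
Hypothesis c_gt0 : 0 < c.
Hypothesis c_le : forall j, (c%:E <= cylinder_mass (D j))%E.

(** The coordinates of s in A N leave a conditional probability at least c to
every D j. *)
Let good N s := forall j, ((c * W N s)%:E <= conditional_mass (D j) N s)%E.

Let good0 : good 0 point.
Proof. by move=> j; rewrite W0 mulr1; exact: c_le. Qed.

(** By dominated convergence, the average over the next block of the limit in j
of the conditional masses is at least c W; a limit that is everywhere below
c W would have a smaller average. *)
Let good_step N s : good N s -> exists t, good N.+1 (splice (A N) (s, t)).
Proof.
move=> gs; apply/not_existsP => bad.
pose g j t := conditional_mass (D j) N.+1 (splice (A N) (s, t)).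
pose f t := (c * W N.+1 (splice (A N) (s, t)))%:E.
have mg j : measurable_fun setT (g j).
  by apply: measurable_section_splice; exact: measurable_conditional_mass.
have mW' : measurable_fun setT (fun t => (W N.+1 (splice (A N) (s, t)))%:E).
  apply: (@measurable_section_splice (EFin \o W N.+1)); exact/measurable_EFinP.
have If : (\int[PA N.+1]_t f t = (c * W N s)%:E)%E.
  rewrite /f; under eq_integral do rewrite EFinM.
  rewrite ge0_integralZl//; [|by move=> t _; rewrite lee_fin ltW|by rewrite lee_fin ltW].
  by rewrite -/(resample N (EFin \o W N.+1) s) resample_W.
have g0 j t : (0 <= g j t)%E by exact: conditional_mass_ge0.
have gW j t : (g j t <= (W N.+1 (splice (A N) (s, t)))%:E)%E.
  exact: conditional_mass_le.
have decrg t : nonincreasing_seq (g ^~ t).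
  apply/nonincreasing_seqP => j; exact: le_conditional_mass.
pose l t := ereal_inf (range (g ^~ t)).
have lcvg t : (g ^~ t @ \oo --> l t)%classic by exact: ereal_nonincreasing_cvgn.
have ml : measurable_fun setT l.
  by apply: (emeasurable_fun_cvg g) => // t _; exact: lcvg.
have Icvg : ((\int[PA N.+1]_t g j t)%E @[j --> \oo] --> (\int[PA N.+1]_t l t)%E)%classic.
  apply: (@dominated_cvg _ _ _ _ setT measurableT g l
            (fun t => (W N.+1 (splice (A N) (s, t)))%:E)) => //.
  - apply/integrableP; split => //.
    under eq_integral do rewrite gee0_abs ?lee_fin ?ltW//.
    by rewrite -/(resample N (EFin \o W N.+1) s) resample_W ltry.
  - by move=> j t _; rewrite gee0_abs.
have Ifl : (\int[PA N.+1]_t f t <= \int[PA N.+1]_t l t)%E.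
  rewrite If -(cvg_lim _ Icvg)//; apply: lime_ge.
    by apply/cvg_ex; eexists; exact: Icvg.
  apply: nearW => j; rewrite -/(resample N (conditional_mass (D j) N.+1) s).
  by rewrite -conditional_mass_step.
have : (\int[PA N.+1]_t l t < \int[PA N.+1]_t f t)%E.
  apply: lt_integral_probability => //.
  - apply/measurable_EFinP; apply: measurable_funM; first exact: measurable_cst.
    exact/measurable_EFinP.
  - by move=> t; apply/le_ereal_inf_tmp => _ [j _ <-].
  - move=> t; have /existsNP[j /negP] := bad t; rewrite -ltNge; apply: le_lt_trans.
    by apply: ereal_inf_lbound; exists j.
  - by rewrite If ltry.
by rewrite ltNge Ifl.
Qed.

(** Choosing one good block after the other produces a configuration s; for N
beyond the level of D j, the conditional mass of D j given s is W N s or 0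
according as s is in D j or not, and it is positive. *)
Lemma cylinders_common_point : exists s, forall j, D j s.
Proof.
have /choice[next nextP] : forall Ns : nat * Om, exists t,
    good Ns.1 Ns.2 -> good Ns.1.+1 (splice (A Ns.1) (Ns.2, t)).
  move=> [N s]; case: (pselect (good N s)) => [/good_step[t gt]|bs].
    by exists t.
  by exists point.
pose sq := nat_rect (fun=> Om) point
             (fun N s => splice (A N) (s, next (N, s))).
have sqS N : sq N.+1 = splice (A N) (sq N, next (N, sq N)) by [].
have gsq N : good N (sq N).
  by elim: N => [|N IH]; [exact: good0|rewrite sqS; exact: (nextP (N, sq N))].
have sq_agree N i : {in A N, sq (i + N)%N =1 sq N}.
  elim: i => // i IH v vN; rewrite addSn sqS splice_in ?IH//.
  by apply: (fsubsetP (subA_le _)) vN; rewrite leq_addl.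
have /choice[lev levP] := coverA.
pose s : Om := fun v => sq (lev v) v.
have sE N : {in A N, s =1 sq N}.
  move=> v vN; rewrite /s; case: (leqP N (lev v)) => [|/ltnW] /subnK <-.
    by rewrite sq_agree.
  by rewrite sq_agree.
exists s => j; have dD := levelP (fD j).
set N := level (D j) in dD *.
apply: (dD (sq N)); first by move=> v /sE.
have := gsq N j; rewrite conditional_mass_determined// lee_fin indicE.
case: (boolP (sq N \in D j)) => [/set_mem//|_].
by rewrite mulr0 leNgt mulr_gt0.
Qed.

End path_of_cylinders.

Lemma cylinder_massU D D' : cylinder_sets D -> cylinder_sets D' ->
  D `&` D' = set0 ->
  cylinder_mass (D `|` D') = (cylinder_mass D + cylinder_mass D')%E.
Proof.
move=> [mD fD] [mD' fD'] DD'.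
have dN := levelP fD; have dN' := levelP fD'.
set M := maxn (level D) (level D').
have dM : determined (A M) D by apply: determined_sub dN; apply/subA_le/leq_maxl.
have dM' : determined (A M) D' by apply: determined_sub dN'; apply/subA_le/leq_maxr.
rewrite !(@cylinder_massE _ M)//; last 2 first.
- exact: measurableU.
- by move=> s s' ss' [/dM|/dM']; [left|right]; auto.
rewrite ge0_integral_setU//.
- by apply/measurable_EFinP; exact: measurable_funTS.
- by move=> s _; rewrite lee_fin ltW.
- exact/disj_set2P.
Qed.

Lemma cylinder_mass_ge0 D : (0 <= cylinder_mass D)%E.
Proof. exact: conditional_mass_ge0. Qed.

Lemma cylinder_mass_fin_num D : cylinder_sets D -> cylinder_mass D \is a fin_num.
Proof.
move=> [mD fD]; rewrite ge0_fin_numE ?cylinder_mass_ge0//.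
by rewrite (le_lt_trans (conditional_mass_le 0 point mD fD))// ltry.
Qed.

Lemma cylinder_mass0 : cylinder_mass set0 = 0%E.
Proof.
rewrite (@cylinder_massE _ 0)//; first by rewrite integral_set0.
Qed.

(** If U is the disjoint union of the F i, the remainders D n of U form a
decreasing sequence of cylinders with empty intersection, so their masses tend
to 0 by [cylinders_common_point]. *)
Lemma cylinder_mass_sigma_additive :
  @semi_sigma_additive _ R (cylinder_config V T) cylinder_mass.
Proof.
move=> F mF tF mUF; set U := \bigcup_n F n in mUF *.
(* The part of U left uncovered by the first n sets. *)
pose D n : set Om := [set s | U s /\ forall i, (i < n)%N -> ~ F i s].
have DS n : D n.+1 = D n `\` F n.
  apply/seteqP; split => [s [Us nF]|s [[Us nF] nFn]].
    by split; [split => // i /ltnW; exact: nF|exact: nF].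
  split => // i; rewrite ltnS leq_eqVlt => /predU1P[->//|]; exact: nF.
have cD n : cylinder_sets (D n).
  elim: n => [|n IH].
    by rewrite (_ : D 0%N = U)//; apply/seteqP; split => [s []|s Us].
  rewrite DS; exact: (@measurableD _ (cylinder_config V T)).
have cF n : cylinder_sets (F n) by exact: mF.
have FD n : F n `<=` D n.
  move=> s Fs; split; first by exists n.
  move=> i lt_in Fis; have /trivIsetP/(_ i n I I) := tF.
  by rewrite ltn_eqF// => /(_ erefl) /seteqP[/(_ s) + _]; apply.
pose r E := fine (cylinder_mass E).
have rE E : cylinder_sets E -> cylinder_mass E = (r E)%:E.
  by move=> cE; rewrite fineK// cylinder_mass_fin_num.
have rS n : r (D n) = r (F n) + r (D n.+1).
  apply: EFin_inj; rewrite EFinD -!rE//.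
  rewrite -cylinder_massU//.
    congr cylinder_mass; rewrite DS setUC setDKU//; exact: FD.
  by rewrite DS setIDA setIC; apply/seteqP; split => s // [[]].
have sumE n : (\sum_(0 <= i < n) cylinder_mass (F i) = (r U - r (D n))%:E)%E.
  elim: n => [|n IH].
    rewrite big_geq// (_ : D 0%N = U) ?subrr//.
    by apply/seteqP; split => [s []|s Us].
  by rewrite big_nat_recr//= IH rE// -EFinD rS opprD addrA addrAC addrNK.
under eq_fun do rewrite sumE; rewrite rE//.
apply: cvg_EFin; first by apply: nearW.
rewrite -[X in _ --> X]subr0; apply: cvgB; first exact: cvg_cst.
have decr : nonincreasing_seq (r \o D).
  apply/nonincreasing_seqP => n /=; rewrite [leRHS]rS lerDr.
  by rewrite fine_ge0// cylinder_mass_ge0.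
apply/cvgrPdist_lt => c c0.
have [n rn] : exists n, r (D n) < c.
  apply: contrapT => /forallNP rc.
  have [j|j|j|||s sD] := @cylinders_common_point D c.
  - by have [] := cD j.
  - by have [] := cD j.
  - by rewrite DS; exact: subDsetl.
  - by [].
  - by move=> j; rewrite rE// lee_fin leNgt; apply/negP/rc.
  - have [[i _ Fis] _] := sD 0%N.
    by have [_ /(_ i (ltnSn i))] := sD i.+1.
near=> m; rewrite sub0r normrN ger0_norm ?fine_ge0 ?cylinder_mass_ge0//.
by apply: le_lt_trans rn; apply: decr; near: m; exact: nbhs_infty_ge.
Unshelve. all: by end_near. Qed.

(** An extension theorem in the manner of Ionescu-Tulcea: no topology on the
spin space is involved, because the conditional laws are given by densities. *)
Theorem consistent_densities_extension : exists mu : probability Om R,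
  forall N D, measurable D -> determined (A N) D ->
    mu D = (\int[PA N]_(s in D) (W N s)%:E)%E.
Proof.
pose mm : {measure set (cylinder_config V T) -> \bar R} :=
  HB.pack cylinder_mass (@isMeasure.Build _ (cylinder_config V T) R cylinder_mass
    cylinder_mass0 cylinder_mass_ge0 cylinder_mass_sigma_additive).
pose I := g_sigma_algebraType (@measurable _ (cylinder_config V T)).
have mid : measurable_fun setT (id : I -> Om).
  by move=> _ D mD; rewrite setTI -[_ @^-1` _]/D; rewrite -cylinder_sets_generate in mD.
pose f : {mfun I >-> Om} := HB.pack (id : I -> Om) (isMeasurableFun.Build _ _ _ _ _ mid).
have nuE N (D : set Om) : measurable D -> determined (A N) D ->
    measure_extension mm D = (\int[PA N]_(s in D) (W N s)%:E)%E.
  move=> mD dD; rewrite -cylinder_massE//.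
  by apply: (@measurable_mu_extE _ _ _ mm); split => //; exists (A N).
have nuT : measure_extension mm setT = 1%E.
  rewrite (nuE 0%N setT)//; under eq_integral do rewrite W0.
  exact: integral_cst_probability.
pose nu : probability I R := HB.pack (measure_extension mm)
  (Measure_isProbability.Build _ _ _ (measure_extension mm) nuT).
by exists (distribution nu f) => N D mD dD; exact: nuE.
Qed.

End consistent_densities.

(** * Combinatorics of a rooted Cayley tree *)
Section rooted_tree.
Context (V : choiceType) (e : rel V) (k : nat) (x0 : V).
Hypothesis tree : cayley_tree e k.
Local Notation dist x := (gdist e x x0).

Lemma gdist_walk x : walk e x x0 (dist x).
Proof.
rewrite /gdist; case: pselect => [h|[]].
  by case: ex_minnP => m /asboolP.
by have [m w] := cayley_connected tree x x0; exists m; apply/asboolP.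
Qed.

Lemma gdist_min x m : walk e x x0 m -> (dist x <= m)%N.
Proof.
move=> w; rewrite /gdist; case: pselect => // h.
by case: ex_minnP => i _; apply; exact/asboolP.
Qed.

Lemma gdist_root : dist x0 = 0%N.
Proof. by apply/eqP; rewrite -leqn0; apply: gdist_min; exists [::]. Qed.

Lemma gdist_eq0 x : (dist x == 0%N) = (x == x0).
Proof.
apply/eqP/eqP => [d0|->]; last exact: gdist_root.
by have [[|y p] []] := gdist_walk x; rewrite d0.
Qed.

Lemma gdist_edge x y : e x y -> (dist x <= (dist y).+1)%N.
Proof.
move=> exy; apply: gdist_min; have [p [ep lp sp]] := gdist_walk y.
by exists (y :: p); split; rewrite /= ?exy ?sp.
Qed.

Lemma parent_exists x : x != x0 -> exists y, e x y /\ (dist y).+1 = dist x.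
Proof.
move=> xx0; have [[|y p] [/= ep lp sp]] := gdist_walk x.
  by rewrite lp eqxx in xx0.
case/andP: ep => exy ep; exists y; split => //; apply/eqP.
rewrite eqn_leq (gdist_edge exy) andbT -sp ltnS; apply: gdist_min.
by exists p.
Qed.

Definition parent x : V := xget x0 [set y | e x y /\ (dist y).+1 = dist x].

Lemma parentP x : x != x0 -> e x (parent x) /\ (dist (parent x)).+1 = dist x.
Proof.
move=> /parent_exists[y yP].
by apply: (@xgetPex _ x0 [set y | e x y /\ (dist y).+1 = dist x]); exists y.
Qed.

(** Going up to the parents until the two branches meet joins two vertices of a
sphere through the interior of the ball. An edge inside a sphere, or a vertex
with two parents, would close such a path into a cycle. *)
Lemma sphere_path N x y : x != y -> dist x = N -> dist y = N ->
  exists p, [/\ path e x (rcons p y), uniq (x :: rcons p y),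
    (forall z, z \in p -> (dist z < N)%N) & p != [::]].
Proof.
elim: N x y => [|N IH] x y xy dx dy.
  have /eqP xE : x == x0 by rewrite -gdist_eq0 dx.
  have /eqP yE : y == x0 by rewrite -gdist_eq0 dy.
  by rewrite xE yE eqxx in xy.
have nroot z : dist z = N.+1 -> z != x0.
  by move=> dz; apply: contra_eq_neq dz => ->; rewrite gdist_root.
have [exx' [dx']] : e x (parent x) /\ (dist (parent x)).+1 = N.+1.
  by rewrite -dx; apply/parentP/nroot.
have [eyy' [dy']] : e y (parent y) /\ (dist (parent y)).+1 = N.+1.
  by rewrite -dy; apply/parentP/nroot.
move: exx' eyy' dx' dy'; set x' := parent x; set y' := parent y => exx' eyy' dx' dy'.
have join p : path e x' p -> last x' p = y' -> uniq (x' :: p) ->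
    (forall z, z \in x' :: p -> (dist z < N.+1)%N) ->
    exists p, [/\ path e x (rcons p y), uniq (x :: rcons p y),
      (forall z, z \in p -> (dist z < N.+1)%N) & p != [::]].
  move=> ep lp up dp; exists (x' :: p); split => //.
    rewrite rcons_path /= exx' ep/= lp.
    by rewrite (cayley_sym tree).
  rewrite cons_uniq rcons_uniq mem_rcons in_cons (negPf xy) up andbT.
  apply/andP; split; apply/negP.
    by move/dp; rewrite dx ltnn.
  by move/dp; rewrite dy ltnn.
have [x'y'|x'y'] := eqVneq x' y'.
  by apply: (join [::]) => // z /[!inE] /eqP ->; rewrite dx'.
have [p [ep up dp _]] := IH _ _ x'y' dx' dy'.
apply: (join (rcons p y')) => //; first by rewrite last_rcons.
move=> z; rewrite inE mem_rcons inE => /or3P[/eqP->|/eqP->|/dp/ltnW//].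
  by rewrite dx'.
by rewrite dy'.
Qed.

Lemma sphere_independent x y : e x y -> dist x != dist y.
Proof.
move=> exy; apply/eqP => dxy.
have xy : x != y by apply: contraTneq exy => ->; rewrite (cayley_irr tree).
have [p [ep up _ p0]] := sphere_path xy dxy erefl.
apply: (cayley_acyclic tree (c := x :: rcons p y)).
  by case: p p0 {ep up} => //= z p _; rewrite size_rcons.
apply/andP; split => //=; rewrite rcons_path ep last_rcons.
by rewrite (cayley_sym tree).
Qed.

Lemma parent_unique z x y : e z x -> e z y -> (dist x).+1 = dist z ->
  (dist y).+1 = dist z -> x = y.
Proof.
move=> ezx ezy dx dy; apply/eqP/negPn/negP => xy.
have [p [ep up dp p0]] := sphere_path xy erefl (succn_inj (etrans dy (esym dx))).
apply: (cayley_acyclic tree (c := z :: x :: rcons p y)).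
  by rewrite /= size_rcons.
rewrite /ucycle/= ezx/= rcons_path ep last_rcons (cayley_sym tree) ezy/=.
move: up; rewrite cons_uniq => /andP[-> ->]; rewrite !andbT.
rewrite inE mem_rcons inE !negb_or; apply/and3P; split.
- by apply/eqP => zx; move: dx; rewrite zx => /esym /n_Sn.
- by apply/eqP => zy; move: dy; rewrite zy => /esym /n_Sn.
- by apply/negP => /dp; rewrite -dx ltnNge leqnSn.
Qed.

Lemma edge_parent x y : e x y ->
  (x != x0 /\ y = parent x) \/ (y != x0 /\ x = parent y).
Proof.
move=> exy; have eyx : e y x by rewrite (cayley_sym tree).
have := sphere_independent exy; rewrite neq_ltn => /orP[lt|lt]; [right|left].
  have y0 : y != x0 by rewrite -gdist_eq0 -lt0n (leq_ltn_trans _ lt).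
  have [eyp dp] := parentP y0; split => //.
  apply: (parent_unique eyx eyp) => //.
  by apply/eqP; rewrite eqn_leq lt (gdist_edge eyx).
have x_0 : x != x0 by rewrite -gdist_eq0 -lt0n (leq_ltn_trans _ lt).
have [exp dp] := parentP x_0; split => //.
apply: (parent_unique exy exp) => //.
by apply/eqP; rewrite eqn_leq lt (gdist_edge exy).
Qed.

Lemma finite_sphere N : finite_set (graph_sphere e x0 N).
Proof.
elim: N => [|N IH].
  apply: (@sub_finite_set _ _ [set x0]); last exact: finite_set1.
  by move=> x /eqP; rewrite gdist_eq0 => /eqP.
apply: (@sub_finite_set _ _ (\bigcup_(x in graph_sphere e x0 N) [set y | e x y])).
  move=> y dy; have y0 : y != x0.
    by rewrite -gdist_eq0; rewrite /graph_sphere/= in dy; rewrite dy.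
  have [eyp dp] := parentP y0; exists (parent y).
    by rewrite /graph_sphere/=; move: dp; rewrite [dist y]dy => -[].
  by rewrite /= (cayley_sym tree).
apply: bigcup_finite => // x _; have [s [_ _ sE]] := cayley_degree tree x.
have -> : [set y | e x y] = [set` s].
  by apply/seteqP; split => y /=; rewrite sE.
exact: finite_seq.
Qed.

Lemma in_ball N x : (x \in graph_ball e x0 N) = (dist x <= N)%N.
Proof.
rewrite /graph_ball in_fset_set; last first.
  by apply: bigcup_finite => [|i _]; [exact: finite_II|exact: finite_sphere].
apply/idP/idP => [/set_mem[i /= iN di]|dN].
  by rewrite -ltnS (leq_ltn_trans _ iN)// di.
by apply/mem_set; exists (dist x).
Qed.

Lemma ball_mono N : (graph_ball e x0 N `<=` graph_ball e x0 N.+1)%fset.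
Proof. by apply/fsubsetP => x; rewrite !in_ball => /leqW. Qed.

Definition offspring x := if x == x0 then k.+1 else k.

(** All the k + 1 neighbours of x are its children, except for the parent. *)
Lemma count_children N x : dist x = N ->
  count (fun y => (dist y == N.+1) && (parent y == x)) (graph_ball e x0 N.+1) =
  offspring x.
Proof.
move=> dx; have [s [us ss sE]] := cayley_degree tree x.
transitivity (count (fun y => dist y == N.+1) s).
  rewrite -!size_filter; apply/perm_size/uniq_perm; rewrite ?filter_uniq//.
  move=> y; rewrite !mem_filter in_ball sE -andbA unfold_in.
  apply: andb_id2l => /eqP dy; rewrite dy leqnn andbT.
  have y0 : y != x0 by rewrite -gdist_eq0 dy.
  have [eyp [dp]] := parentP y0.
  apply/eqP/idP => [<-|exy]; first by rewrite (cayley_sym tree).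
  apply: (parent_unique eyp); rewrite ?(cayley_sym tree y)// dx ?dy//.
have dE y : e x y -> (dist y == N.+1) = (x == x0) || (y != parent x).
  move=> exy; apply/eqP/orP => [dy|].
    have [->|xx0] := eqVneq x x0; [by left|right].
    apply/eqP => yp; have [_] := parentP xx0.
    by rewrite -yp dy dx => /eqP; rewrite eqn_leq ltnNge leqnSn.
  move=> xy; case: (edge_parent exy) => -[].
    by move=> xx0 yp; move: xy; rewrite (negPf xx0) yp eqxx => -[].
  by move=> yx0 xp; have [_ <-] := parentP yx0; rewrite -xp dx.
have -> : count (fun y => dist y == N.+1) s =
          count (fun y => (x == x0) || (y != parent x)) s.
  by apply: eq_in_count => y; rewrite sE => /dE.
rewrite /offspring; have [xx0|xx0] := eqVneq x x0.
  by rewrite count_predT.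
have ps : parent x \in s by rewrite sE; have [] := parentP xx0.
by have := count_predC (pred1 (parent x)) s; rewrite count_uniq_mem// ps ss => -[].
Qed.

(** Grouping the vertices of a sphere by parents; the exponent is the number of
children. *)
Lemma prod_sphere_parent (R : comPzRingType) N (g : V -> R) :
  \prod_(y <- graph_ball e x0 N.+1 | dist y == N.+1) g (parent y) =
  \prod_(x <- graph_ball e x0 N | dist x == N) g x ^+ offspring x.
Proof.
transitivity (\prod_(y <- graph_ball e x0 N.+1 | dist y == N.+1)
   \prod_(x <- graph_ball e x0 N | (dist x == N) && (x == parent y)) g x).
  apply: eq_bigr => y /eqP dy.
  have y0 : y != x0 by rewrite -gdist_eq0 dy.
  have [_ [dp]] := parentP y0; rewrite dy in dp; case: dp => dp.
  rewrite big_mkcond/= (bigD1_seq (parent y)) ?in_ball ?fset_uniq ?dp//=.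
  by rewrite !eqxx big1 ?mulr1// => x xy; rewrite (negPf xy) andbF.
rewrite (exchange_big_dep (fun x => dist x == N))/=; last by move=> y x _ /andP[].
apply: eq_bigr => x /eqP dx; rewrite big_const_seq iter_mulr_1.
congr (_ ^+ _); rewrite -(count_children dx); apply: eq_count => y.
by rewrite dx eqxx [x == _]eq_sym.
Qed.

Section edge_product.
Variable R : realType.
Variable K : R -> R -> R.
Hypothesis Ksym : forall t u, K t u = K u t.

Lemma edge_weight_pair (A : {fset V}) (s : config A (spin R)) (x y : A) : x != y ->
  edge_weight K s [set x; y]%SET = K (spin_val (s x)) (spin_val (s y)).
Proof.
move=> xy; rewrite /edge_weight.
have := cards2 x y; rewrite xy cardE.
have := enum_uniq [set x; y]%SET.
have enumE : enum [set x; y]%SET =i [set x; y]%SET by move=> z; rewrite mem_enum.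
case: (enum _) enumE => [|a [|b [|]]]//= E; rewrite inE andbT => ab _.
have := E a; have := E b; rewrite !inE !eqxx !orbT.
move=> /esym/orP[/eqP bE|/eqP bE] /esym/orP[/eqP aE|/eqP aE].
- by rewrite aE bE eqxx in ab.
- by rewrite aE bE.
- by rewrite aE bE Ksym.
- by rewrite aE bE eqxx in ab.
Qed.

(** Each edge of the ball joins a vertex other than the root to its parent, and
y is recovered from the edge as the endpoint farther from the root. *)
Lemma prod_edges N (sigma : config V (spin R)) :
  \prod_(a in edges e (graph_ball e x0 N))
     edge_weight K (@restriction R V (graph_ball e x0 N) sigma) a =
  \prod_(y <- graph_ball e x0 N | y != x0)
     K (spin_val (sigma (parent y))) (spin_val (sigma y)).
Proof.
set A := graph_ball e x0 N.
pose pA (y : A) : A := insubd y (parent (val y)).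
have valpA y : val y != x0 -> val (pA y) = parent (val y).
  move=> y0; rewrite /pA val_insubd in_ball ifT//.
  have [_ dp] := parentP y0; have := fsvalP y; rewrite in_ball -dp.
  exact: ltnW.
pose h (y : A) := [set pA y; y]%SET.
have nep y : val y != x0 -> pA y != y.
  move=> y0; apply/eqP => /(congr1 val); rewrite valpA// => py.
  by have [_ ] := parentP y0; rewrite py => /esym /n_Sn.
have -> : edges e A = (h @: [set y : A | val y != x0])%SET.
  apply/setP => a; apply/idP/imsetP.
    rewrite inE => /existsP[x /existsP[y /andP[exy /eqP->]]].
    have [[xx0 yp]|[yx0 xp]] := edge_parent exy.
      exists x; rewrite ?inE// /h (_ : pA x = y) 1?finset.setUC//.
      by apply: val_inj; rewrite valpA.
    exists y; rewrite ?inE// /h (_ : pA y = x)//.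
    by apply: val_inj; rewrite valpA.
  move=> [y]; rewrite inE => y0 ->; rewrite inE.
  apply/existsP; exists (pA y); apply/existsP; exists y.
  by rewrite valpA// (cayley_sym tree) (parentP y0).1/=.
rewrite big_imset/=; last first.
  move=> y z; rewrite !inE => y0 z0 /setP hyz.
  have := hyz y; rewrite !inE eqxx orbT => /esym/orP[/eqP yz|/eqP//].
  have := hyz z; rewrite !inE eqxx orbT => /orP[/eqP zy|/eqP//].
  have [_ dy] := parentP y0; have [_ dz] := parentP z0.
  move: dy dz; rewrite -(valpA _ y0) -(valpA _ z0) -yz -zy => <- /esym.
  by move=> /eqP; rewrite -addn2 -[X in X == _]addn0 eqn_add2l.
transitivity (\prod_(y : A | val y != x0)
     K (spin_val (sigma (parent (val y)))) (spin_val (sigma (val y)))).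
  apply: eq_big => [y|y]; rewrite inE// => y0.
  by rewrite /h edge_weight_pair ?nep// /restriction valpA.
by rewrite -(big_seq_fsetE _ _ (fun y => y != x0)
  (fun y => K (spin_val (sigma (parent y))) (spin_val (sigma y)))).
Qed.

End edge_product.

End rooted_tree.

(** * The odd root and its moments *)
Lemma continuous_funX (R : realType) (g : R -> R) m : continuous g ->
  continuous (fun u => g u ^+ m).
Proof.
move=> cg u; apply: (@cvg_comp _ _ _ g (fun y => y ^+ m) _ (nbhs (g u))).
  exact: cg.
exact: exprn_continuous.
Qed.

Section odd_root.
Variables (R : realType) (n : nat).
Local Notation p := n.*2.+1.
Local Notation root := (@odd_root R n).
Local Notation mu := (@lebesgue_measure R).

Lemma odd_rootM x y : root (x * y) = root x * root y.
Proof. by rewrite /odd_root sgrM normrM powRM// mulrACA. Qed.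

Lemma ltr_odd_exp (x y : R) : (x ^+ p < y ^+ p) = (x < y).
Proof.
have homo (a b : R) : a < b -> a ^+ p < b ^+ p.
  move=> ab; have [a0|a0] := leP 0 a.
    by rewrite ltrXn2r// ltW// (le_lt_trans a0).
  have aE (c : R) : c ^+ p = - ((- c) ^+ p).
    by rewrite exprNn -signr_odd/= odd_double expr1 mulN1r opprK.
  have [b0|b0] := leP 0 b.
    rewrite (@lt_le_trans _ _ 0)// ?exprn_ge0//.
    by rewrite aE oppr_lt0 exprn_gt0// oppr_gt0.
  by rewrite aE (aE b) ltrN2 ltrXn2r ?ltrN2 ?oppr_ge0 ?ltW.
apply/idP/idP; last exact: homo.
rewrite !ltNge; apply: contra; rewrite !le_eqVlt.
by move=> /predU1P[->|/homo->]; rewrite ?eqxx ?orbT.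
Qed.

Lemma ltr_odd_root x y : (root x < root y) = (x < y).
Proof. by rewrite -ltr_odd_exp !odd_rootK. Qed.

Lemma odd_root_exp x : root (x ^+ p) = x.
Proof.
by case: (ltgtP (root (x ^+ p)) x) => //; rewrite -ltr_odd_exp odd_rootK ltxx.
Qed.

(** The root is an increasing bijection with inverse the odd power, so the
preimage of an interval around root x is the interval between the powers of its
endpoints. *)
Lemma continuous_odd_root : continuous root.
Proof.
move=> x; apply/cvgrPdist_lt => eps eps0.
have lo : (root x - eps) ^+ p < x.
  by rewrite -[ltRHS](odd_rootK n) ltr_odd_exp ltrBlDr ltrDl.
have hi : x < (root x + eps) ^+ p.
  by rewrite -[ltLHS](odd_rootK n) ltr_odd_exp ltrDl.
have xI : x \in `](root x - eps) ^+ p, (root x + eps) ^+ p[ by rewrite in_itv/= lo.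
near=> y; have : y \in `](root x - eps) ^+ p, (root x + eps) ^+ p[.
  by near: y; exact: near_in_itvoo.
rewrite in_itv/= -{1 2}(odd_rootK n y) !ltr_odd_exp => /andP[y1 y2].
by rewrite ltr_distlC; apply/andP.
Unshelve. all: by end_near. Qed.

Definition phi (u : R) : R := root (2 * u - 1).

Lemma phi0 : phi 0 = -1.
Proof.
rewrite /phi mulr0 sub0r -[RHS]odd_root_exp.
by rewrite -signr_odd/= odd_double expr1.
Qed.

Lemma phi_half : phi (2^-1) = 0.
Proof. by rewrite /phi mulfV ?subrr// /odd_root sgr0 mul0r. Qed.

Lemma phi1 : phi 1 = 1.
Proof. by rewrite /phi mulr1 addrK -[RHS]odd_root_exp expr1n. Qed.

Lemma ltr_phi u v : (phi u < phi v) = (u < v).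
Proof. by rewrite ltr_odd_root ltrD2r ltr_pM2l. Qed.

Lemma ler_phi u v : (phi u <= phi v) = (u <= v).
Proof. by rewrite !leNgt ltr_phi. Qed.

Lemma phi_itv u : u \in `[0, 1] -> -1 <= phi u <= 1.
Proof. by rewrite in_itv/= -(ler_phi 0) -(ler_phi u) phi0 phi1. Qed.

Lemma odd_root_interaction t u :
  root (4 * (t - 2^-1) * (u - 2^-1)) = phi t * phi u.
Proof. by rewrite -odd_rootM; congr root; field. Qed.

Lemma continuous_phi : continuous phi.
Proof.
move=> u; apply: (@cvg_comp _ _ _ (fun u => 2 * u - 1) root _ (nbhs (2 * u - 1))).
  by apply: cvgB; [apply: cvgM; [exact: cvg_cst|exact: cvg_id]|exact: cvg_cst].
exact: continuous_odd_root.
Qed.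

Lemma continuous_integrable_unit (g : R -> R) :
  {within `[0, 1], continuous g} -> mu.-integrable `[0, 1] (EFin \o g).
Proof. by move=> cg; apply: continuous_compact_integrable => //; exact: segment_compact. Qed.

(** The value of the integral of phi^j over the unit interval, see
[integral_phiX]. *)
Definition moment (j : nat) : R := if odd j then 0 else p%:R / (p + j)%:R.

(** The substitution u = (1 + v^p) / 2 turns phi(u) into v and the integrand
into a polynomial on [-1, 1]. *)
Lemma integral_phiX j : \int[mu]_(u in `[0, 1]) phi u ^+ j = moment j.
Proof.
(* F is the substitution and H a primitive of v^j F'(v). *)
pose F := horner (2^-1 *: (1 + 'X^p) : {poly R}).
pose H := horner ((p%:R / 2 / (p + j)%:R) *: 'X^(p + j) : {poly R}).
have FE v : F v = (1 + v ^+ p) / 2 by rewrite /F !hornerE mulrC.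
have sgnN : (-1) ^+ p = -1 :> R by rewrite -signr_odd/= odd_double expr1.
have F1 : F 1 = 1 by rewrite FE expr1n; field.
have FN1 : F (-1) = 0 by rewrite FE sgnN subrr mul0r.
have F'E v : F^`()%classic v = p%:R / 2 * v ^+ n.*2.
  rewrite derive1E derive_val derivZ derivD -polyC1 derivC add0r derivXn.
  by rewrite !hornerE hornerMn hornerXn -mulr_natl; field.
have H'E v : H^`()%classic v = v ^+ j * (p%:R / 2 * v ^+ n.*2).
  rewrite derive1E derive_val derivZ derivXn !hornerE hornerMn hornerXn.
  rewrite (_ : (p + j).-1 = (n.*2 + j)%N) ?addSn// -addSn exprD -[(_ * _) *+ _]mulr_natl.
  have : (p + j)%:R != 0 :> R by rewrite pnatr_eq0.
  by move: (p + j)%:R => q q0 /=; field.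
have cF' : continuous F^`()%classic.
  have -> : F^`()%classic = horner ((p%:R / 2) *: 'X^(n.*2)).
    by apply/funext => v; rewrite F'E !hornerE.
  exact: continuous_horner.
have LR (q : {poly R}) (a b : R) : derivable_oo_LRcontinuous (horner q) a b.
  split; first by move=> v _; exact: derivable_horner.
    by apply: cvg_at_right_filter; exact: continuous_horner.
  by apply: cvg_at_left_filter; exact: continuous_horner.
have cG : continuous (fun u => phi u ^+ j).
  by apply: continuous_funX; exact: continuous_phi.
have cGF : {within `[-1, 1], continuous (((fun u => phi u ^+ j) \o F) * F^`()%classic)}.
  apply: continuous_subspaceT => v; apply: cvgM; last exact: cF'.
  apply: (@cvg_comp _ _ _ F (fun u => phi u ^+ j) _ (nbhs (F v))); last exact: cG.
  exact: continuous_horner.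
transitivity (fine (\int[mu]_(u in `[F (-1), F 1]) ((fun u => phi u ^+ j) u)%:E)).
  by rewrite FN1 F1.
rewrite (@integration_by_substitution_increasing _ F (fun u => phi u ^+ j) (-1) 1).
- rewrite (@continuous_FTC2 _ _ H)//.
  + rewrite -EFinB/= /H !hornerE !expr1n /moment mulr1.
    rewrite exprD sgnN mulN1r -signr_odd.
    have : (p + j)%:R != 0 :> R by rewrite pnatr_eq0.
    move: (p + j)%:R => q q0.
    by case: (odd j); rewrite /= ?expr0 ?expr1; field.
  + exact: LR.
  + move=> v _; transitivity (phi (F v) ^+ j * F^`()%classic v); last by [].
    rewrite H'E F'E; congr (_ ^+ _ * _).
    rewrite /phi FE (_ : 2 * _ - 1 = v ^+ p) ?odd_root_exp//.
    by field.
- by lra.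
- by move=> u v _ _ uv; rewrite !FE ltr_pM2r// ltrD2l ltr_odd_exp.
- by move=> v _; exact: cF'.
- by apply: cvgP; apply: cvg_at_right_filter; exact: cF'.
- by apply: cvgP; apply: cvg_at_left_filter; exact: cF'.
- exact: LR.
- exact: continuous_subspaceT.
Qed.

End odd_root.

(** * The bifurcation polynomial *)
Section bifurcation_polynomial.
Variables (R : realType) (n k : nat) (theta : R).
Hypothesis theta_itv : 0 <= theta < 1.
Local Notation p := n.*2.+1.
Local Notation phi := (@phi R n).
Local Notation moment := (@moment R n).
Local Notation mu := (@lebesgue_measure R).

Definition affine (x u : R) : R := 1 + x * phi u.

Definition mass (x : R) : R := \int[mu]_(u in `[0, 1]) affine x u ^+ k.

Definition bias (x : R) : R := \int[mu]_(u in `[0, 1]) (phi u * affine x u ^+ k).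

Lemma continuous_affine x : continuous (affine x).
Proof.
move=> u; apply: cvgD; first exact: cvg_cst.
by apply: cvgM; [exact: cvg_cst|exact: continuous_phi].
Qed.

Lemma continuous_affineX x m : continuous (fun u => affine x u ^+ m).
Proof. by apply: continuous_funX; exact: continuous_affine. Qed.

Lemma continuous_phiX m : continuous (fun u => phi u ^+ m).
Proof. by apply: continuous_funX; exact: continuous_phi. Qed.

Lemma continuous_sum_phiX (a : nat -> R) m d :
  continuous (fun u => \sum_(i < m) a i * phi u ^+ (d + i)).
Proof.
elim: m => [|m IH] u.
  by under eq_fun do rewrite big_ord0; exact: cvg_cst.
under eq_fun do rewrite big_ord_recr/=.
apply: cvgD; first exact: IH.
by apply: cvgM; [exact: cvg_cst|exact: continuous_phiX].
Qed.

Lemma integral_sum_phiX (a : nat -> R) m d :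
  \int[mu]_(u in `[0, 1]) (\sum_(i < m) a i * phi u ^+ (d + i)) =
  \sum_(i < m) a i * moment (d + i).
Proof.
have int_phiX j : mu.-integrable `[0, 1] (EFin \o (fun u => phi u ^+ j)).
  by apply/continuous_integrable_unit/continuous_subspaceT; exact: continuous_phiX.
elim: m => [|m IH].
  under eq_Rintegral do rewrite big_ord0.
  by rewrite big_ord0 Rintegral_cst// mul0r.
under eq_Rintegral do rewrite big_ord_recr/=.
rewrite RintegralD//=.
- by rewrite IH RintegralZl// integral_phiX big_ord_recr.
- by apply/continuous_integrable_unit/continuous_subspaceT; exact: continuous_sum_phiX.
- apply/continuous_integrable_unit/continuous_subspaceT => u.
  by apply: cvgM; [exact: cvg_cst|exact: continuous_phiX].
Qed.

Lemma affineXE x u :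
  affine x u ^+ k = \sum_(i < k.+1) 'C(k, i)%:R * x ^+ i * phi u ^+ i.
Proof.
rewrite /affine exprDn; apply: eq_bigr => i _.
by rewrite expr1n mul1r exprMn -mulr_natl mulrA.
Qed.

Lemma massE x : mass x = \sum_(i < k.+1) 'C(k, i)%:R * x ^+ i * moment i.
Proof.
rewrite /mass; under eq_Rintegral do rewrite affineXE.
exact: (integral_sum_phiX (fun i => 'C(k, i)%:R * x ^+ i) k.+1 0).
Qed.

Lemma biasE x : bias x = \sum_(i < k.+1) 'C(k, i)%:R * x ^+ i * moment i.+1.
Proof.
rewrite /bias -(integral_sum_phiX (fun i => 'C(k, i)%:R * x ^+ i) k.+1 1).
apply: eq_Rintegral => u _; rewrite affineXE mulr_sumr; apply: eq_bigr => i _.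
by rewrite add1n exprS; ring.
Qed.

(** The coefficient of x^i in the integral of (1 + x phi)^k minus theta / x times
the integral of phi (1 + x phi)^k. *)
Definition bif_coef i : R :=
  'C(k, i)%:R * moment i - theta * ('C(k, i.+1)%:R * moment i.+2).

Definition bif_poly : {poly R} := \poly_(i < k.+1) bif_coef i.

Lemma moment_odd i : odd i -> moment i = 0.
Proof. by rewrite /moment => ->. Qed.

Lemma moment_ge0 i : 0 <= moment i.
Proof. by rewrite /moment; case: ifP => // _; rewrite divr_ge0. Qed.

Lemma bif_polyE x : bif_poly.[x] = \sum_(i < k.+1) bif_coef i * x ^+ i.
Proof. by rewrite horner_poly. Qed.

Lemma bif_equation x : x * mass x - theta * bias x = x * bif_poly.[x].
Proof.
have biasS : bias x = x * \sum_(i < k.+1) 'C(k, i.+1)%:R * x ^+ i * moment i.+2.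
  rewrite biasE big_ord_recl/= moment_odd// mulr0 add0r.
  rewrite [in RHS]big_ord_recr/= bin_small// !mul0r addr0 mulr_sumr.
  by apply: eq_bigr => i _; rewrite /bump/= add1n exprS; ring.
rewrite biasS massE bif_polyE mulrCA -mulrBr mulr_sumr -sumrB; congr (_ * _).
by apply: eq_bigr => i _; rewrite /bif_coef; ring.
Qed.

Lemma bif_polyN x : bif_poly.[- x] = bif_poly.[x].
Proof.
rewrite !bif_polyE; apply: eq_bigr => i _; rewrite exprNn -signr_odd.
case: (boolP (odd i)) => oi; last by rewrite expr0 mul1r.
by rewrite /bif_coef !moment_odd ?mulr0 ?subrr ?mul0r//= negbK.
Qed.

Lemma bif_poly0 : bif_poly.[0] = bif_coef 0.
Proof.
rewrite bif_polyE big_ord_recl big1 => [|i _]; last by rewrite expr0n mulr0.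
by rewrite expr0 mulr1 addr0.
Qed.

Lemma affine_gt0 x u : -1 < x < 1 -> u \in `[0, 1] -> 0 < affine x u.
Proof.
move=> /andP[x1 x2] /(phi_itv n)/andP[u1 u2]; rewrite /affine.
have [x0|x0] := leP 0 x; nra.
Qed.

Lemma integrable_affineX x m :
  mu.-integrable `[0, 1] (EFin \o (fun u => affine x u ^+ m)).
Proof.
by apply/continuous_integrable_unit/continuous_subspaceT; exact: continuous_affineX.
Qed.

Lemma integrable_phi_affineX x m :
  mu.-integrable `[0, 1] (EFin \o (fun u => phi u * affine x u ^+ m)).
Proof.
apply/continuous_integrable_unit/continuous_subspaceT => u.
by apply: cvgM; [exact: continuous_phi|exact: continuous_affineX].
Qed.

Lemma Rintegral_cst_unit (c : R) : \int[mu]_(u in `[0, 1]) c = c.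
Proof.
rewrite Rintegral_cst// [X in fine X](_ : _ = 1%E) ?mulr1//.
by rewrite [LHS]lebesgue_measure_itv/= lte_fin ltr01 oppr0 adde0.
Qed.

Lemma mass_gt0 x : -1 < x < 1 -> 0 < mass x.
Proof.
move=> /andP[x1 x2].
have x_lt1 : `|x| < 1 by rewrite ltr_norml x1.
apply: (@lt_le_trans _ _ ((1 - `|x|) ^+ k)); first by rewrite exprn_gt0// subr_gt0.
have <- : \int[mu]_(u in `[0, 1]) ((1 - `|x|) ^+ k) = (1 - `|x|) ^+ k.
  exact: Rintegral_cst_unit.
apply: le_Rintegral => //.
- apply/continuous_integrable_unit/continuous_subspaceT; exact: cst_continuous.
- exact: integrable_affineX.
- move=> u u01; have /(phi_itv n) pu : u \in `[0, 1] by [].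
  have le_aff : 1 - `|x| <= affine x u.
    rewrite lerD2l lerNl (le_trans (ler_norm _))// normrN normrM.
    by rewrite ler_piMr// ler_norml.
  rewrite lerXn2r// nnegrE ?subr_ge0 ?(ltW x_lt1)//.
  by rewrite (le_trans _ le_aff)// subr_ge0 ltW.
Qed.

Lemma bif_poly1_gt0 : 0 < bif_poly.[1].
Proof.
rewrite -[bif_poly.[1]]mul1r -bif_equation mul1r subr_gt0.
have [t0 t1] := andP theta_itv.
have mass1 : 0 < mass 1.
  rewrite massE big_ord_recl/= ltr_wpDr//.
    by apply: sumr_ge0 => i _; rewrite expr1n mulr1 mulr_ge0 ?moment_ge0.
  by rewrite bin0 expr0 /moment/= addn0 divff ?pnatr_eq0// !mul1r ltr01.
apply: (@le_lt_trans _ _ (theta * mass 1)); last by rewrite gtr_pMl.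
apply: ler_wpM2l => //; apply: le_Rintegral => //.
- exact: integrable_phi_affineX.
- exact: integrable_affineX.
- move=> u u01; have /(phi_itv n)/andP[p1 p2] : u \in `[0, 1] by [].
  by rewrite ler_piMl// exprn_ge0// /affine mul1r addrC -lerBlDr sub0r.
Qed.

(** The recurrence of the binomial coefficients and the closed form
p / (p + i) of the even moments give the ratio of the two terms of
[bif_coef i]. *)
Lemma bin_momentS i : ~~ odd i ->
  (i.+1 * (p + i.+2))%:R * ('C(k, i.+1)%:R * moment i.+2) =
  ((k - i) * (p + i))%:R * ('C(k, i)%:R * moment i).
Proof.
move=> ei; rewrite /moment/= negbK (negPf ei).
have := mul_bin_left k i; move/(congr1 (fun m => m%:R : R)); rewrite !natrM.
have : (p + i)%:R != 0 :> R by rewrite pnatr_eq0.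
have : (p + i.+2)%:R != 0 :> R by rewrite pnatr_eq0.
move: (p + i)%:R (p + i.+2)%:R (k - i)%:R i.+1%:R 'C(k, i)%:R 'C(k, i.+1)%:R p%:R.
move=> a b c d e f g b0 a0 E.
have -> : d * b * (f * (g / b)) = d * f * g by field.
by rewrite E; field.
Qed.

(** For even i, the coefficient is a_i - theta b_i where b_i / a_i decreases with
i, as long as a_i > 0, by [bin_momentS]; once it is nonnegative it remains so. *)
Lemma bif_coef_sign i j : ~~ odd i -> (i <= j)%N ->
  0 < 'C(k, i)%:R * moment i -> 0 <= bif_coef i -> 0 <= bif_coef j.
Proof.
move=> ei ij ai0 ci0; have [t0 t1] := andP theta_itv.
case: (boolP (odd j)) => oj.
  by rewrite /bif_coef !moment_odd ?mulr0 ?subrr//= negbK.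
have := bin_momentS ei; have := bin_momentS oj; move: ci0; rewrite /bif_coef.
set ai := 'C(k, i)%:R * _ in ai0 *; set bi := 'C(k, i.+1)%:R * _.
set aj := 'C(k, j)%:R * _; set bj := 'C(k, j.+1)%:R * _ => ci0 Ej Ei.
have aj0 : 0 <= aj by rewrite mulr_ge0 ?moment_ge0.
have ineq : (((k - j) * (p + j)) * (i.+1 * (p + i.+2)) <=
             ((k - i) * (p + i)) * (j.+1 * (p + j.+2)))%N.
  have le1 : (k - j <= k - i)%N by rewrite leq_sub2l.
  have le2 : ((p + j) * (i.+1 * (p + i.+2)) <= (p + i) * (j.+1 * (p + j.+2)))%N.
    by move: ij => /subnK <-; nia.
  by rewrite -!mulnA leq_mul.
have ratio : ai * bj <= aj * bi.
  have c0 : 0 < ((i.+1 * (p + i.+2)) * (j.+1 * (p + j.+2)))%:R :> R by rewrite ltr0n.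
  rewrite -(ler_pM2l c0) natrM.
  have -> : (i.+1 * (p + i.+2))%:R * (j.+1 * (p + j.+2))%:R * (ai * bj) =
    ai * aj * ((((k - j) * (p + j)) * (i.+1 * (p + i.+2)))%:R).
    rewrite natrM; transitivity ((i.+1 * (p + i.+2))%:R * ai * ((j.+1 * (p + j.+2))%:R * bj)).
      by ring.
    by rewrite Ej; ring.
  have -> : (i.+1 * (p + i.+2))%:R * (j.+1 * (p + j.+2))%:R * (aj * bi) =
    ai * aj * ((((k - i) * (p + i)) * (j.+1 * (p + j.+2)))%:R).
    rewrite natrM; transitivity ((j.+1 * (p + j.+2))%:R * aj * ((i.+1 * (p + i.+2))%:R * bi)).
      by ring.
    by rewrite Ei; ring.
  by rewrite ler_wpM2l ?ler_nat// mulr_ge0// ltW.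
rewrite -(pmulr_rge0 _ ai0).
have -> : ai * (aj - theta * bj) = aj * (ai - theta * bi) + theta * (aj * bi - ai * bj).
  by ring.
by rewrite addr_ge0// mulr_ge0// subr_ge0.
Qed.

Lemma moment_neq_odd i : 0 < 'C(k, i)%:R * moment i -> ~~ odd i.
Proof. by apply: contraTN => oi; rewrite moment_odd ?mulr0 ?ltxx. Qed.

Lemma bif_coef_gt0 i : 0 < bif_coef i -> 0 < 'C(k, i)%:R * moment i.
Proof.
have [t0 _] := andP theta_itv.
move=> ci; apply: (lt_le_trans ci); rewrite /bif_coef gerBl.
by rewrite !mulr_ge0 ?moment_ge0.
Qed.

(** All coefficients are nonnegative, so S(x) >= x^k S(1). *)
Lemma bif_poly_gt0 x : 0 <= bif_coef 0 -> 0 < x < 1 -> 0 < bif_poly.[x].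
Proof.
move=> c0 /andP[x0 x1].
have c_ge0 i : 0 <= bif_coef i.
  apply: (@bif_coef_sign 0%N) => //.
  by rewrite bin0 /moment/= addn0 divff ?pnatr_eq0// mul1r ltr01.
apply: (@lt_le_trans _ _ (x ^+ k * bif_poly.[1])).
  by rewrite mulr_gt0 ?exprn_gt0 ?bif_poly1_gt0.
rewrite !bif_polyE mulr_sumr; apply: ler_sum => i _.
rewrite expr1n mulr1 mulrC ler_wpM2l// ler_wiXn2l// ?(ltW x0) ?(ltW x1)//.
by rewrite -ltnS.
Qed.

(** Descartes' rule of signs. Let m be the first index of a positive
coefficient and z = y / x > 1. The coefficients are at most 0 below m and at
least 0 from m on, and so is z^i - z^m; hence the terms of
S(y) - z^m S(x) = sum_i s_i x^i (z^i - z^m) are nonnegative, and the term of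
index 0 is positive. *)
Lemma bif_poly_increasing x y : bif_coef 0 < 0 -> 0 < x -> x < y ->
  bif_poly.[x] = 0 -> 0 < bif_poly.[y].
Proof.
move=> c0 x0 xy Sx.
have [m cm m_min] : exists2 m, 0 < bif_coef m &
    forall i, (i < m)%N -> bif_coef i <= 0.
  have ex : exists m, 0 < bif_coef m.
    apply: contrapT => /forallNP nc; have := bif_poly1_gt0.
    rewrite bif_polyE ltNge sumr_le0// => i _; rewrite expr1n mulr1 leNgt.
    exact/negP/nc.
  case: (ex_minnP ex) => m cm m_min; exists m => // i im.
  by rewrite leNgt; apply: contraTN im => /m_min; rewrite -leqNgt.
have m_gt0 : (0 < m)%N.
  by rewrite lt0n; apply: contraTneq cm => ->; rewrite -leNgt ltW.
have c_ge0 i : (m <= i)%N -> 0 <= bif_coef i.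
  have am := bif_coef_gt0 cm.
  by move=> mi; apply: (bif_coef_sign (moment_neq_odd am) mi am); exact: ltW.
pose z := y / x.
have z1 : 1 < z by rewrite ltr_pdivlMr// mul1r.
have yE : y = z * x by rewrite divfK ?gt_eqF.
have -> : bif_poly.[y] = bif_poly.[y] - z ^+ m * bif_poly.[x] by rewrite Sx mulr0 subr0.
rewrite !bif_polyE mulr_sumr -sumrB big_ord_recl /=.
rewrite ltr_wpDr//.
  apply: sumr_ge0 => i _; set j := bump 0 i.
  have -> : bif_coef j * y ^+ j - z ^+ m * (bif_coef j * x ^+ j) =
            bif_coef j * (z ^+ j - z ^+ m) * x ^+ j.
    by rewrite yE exprMn; ring.
  rewrite mulr_ge0 ?exprn_ge0 ?(ltW x0)//.
  case: (leqP m j) => mj.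
    by rewrite mulr_ge0 ?c_ge0// subr_ge0 ler_weXn2l// ltW.
  by rewrite mulr_le0 ?m_min// subr_le0 ler_weXn2l ?(ltW z1) ?(ltnW mj).
rewrite !expr0 !mulr1 -[X in X - _]mul1r -mulrBl nmulr_lgt0// subr_lt0.
by rewrite exprn_egt1// -lt0n.
Qed.

Lemma bif_coef0 : bif_coef 0 = 1 - theta * (k%:R * (p%:R / (p + 2)%:R)).
Proof.
by rewrite /bif_coef /moment /= bin0 bin1 addn0 divff ?pnatr_eq0// mulr1.
Qed.

Lemma bif_solutions_subcritical x : 0 <= bif_coef 0 -> -1 < x < 1 ->
  x * bif_poly.[x] = 0 -> x = 0.
Proof.
move=> c0 /andP[x1 x2] /eqP; rewrite mulf_eq0 => /predU1P[//|/eqP Sx].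
have [x0|x0|//] := ltgtP x 0.
  have := @bif_poly_gt0 (- x) c0; rewrite bif_polyN Sx ltxx oppr_gt0 x0.
  by rewrite ltrNl x1 => /(_ isT).
by have := @bif_poly_gt0 x c0; rewrite Sx ltxx x0 x2 => /(_ isT).
Qed.

Lemma bif_solutions_supercritical : bif_coef 0 < 0 ->
  exists r, [/\ 0 < r < 1, bif_poly.[r] = 0 &
    forall x, -1 < x < 1 -> x * bif_poly.[x] = 0 -> [\/ x = 0, x = r | x = - r]].
Proof.
move=> c0.
have S0 : bif_poly.[0] < 0 by rewrite bif_poly0.
have S01 : bif_poly.[0] <= 0 <= bif_poly.[1] by rewrite !ltW ?bif_poly1_gt0.
have [r] := poly_ivt ler01 S01.
move=> /andP[r0 r1] /rootP Sr.
have r_gt0 : 0 < r.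
  rewrite lt_neqAle r0 andbT; apply/eqP => rE.
  by move: S0; rewrite {1}rE Sr ltxx.
have r_lt1 : r < 1.
  rewrite lt_neqAle r1 andbT; apply/eqP => rE.
  by have := bif_poly1_gt0; rewrite -rE Sr ltxx.
exists r; split => //; first by rewrite r_gt0.
have uniq_root x : 0 < x -> bif_poly.[x] = 0 -> x = r.
  move=> x0 Sx; case: (ltgtP x r) => // lt.
    by have := bif_poly_increasing c0 x0 lt Sx; rewrite Sr ltxx.
  by have := bif_poly_increasing c0 r_gt0 lt Sr; rewrite Sx ltxx.
move=> x _ /eqP; rewrite mulf_eq0 => /predU1P[->|/eqP Sx]; first exact: Or31.
have [x0|x0|->] := ltgtP x 0; last exact: Or31.
  by apply: Or33; rewrite -(uniq_root (- x)) ?opprK ?bif_polyN ?oppr_gt0.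
by apply: Or32; exact: uniq_root.
Qed.

End bifurcation_polynomial.

(** * Positive fixed points of the Hammerstein operator *)
Section fixed_points.
Variables (R : realType) (n k : nat) (theta : R).
Hypothesis k_gt1 : (1 < k)%N.
Hypothesis theta_itv : 0 <= theta < 1.
Local Notation phi := (@phi R n).
Local Notation mu := (@lebesgue_measure R).
Local Notation affine := (@affine R n).
Local Notation mass := (@mass R n k).
Local Notation bias := (@bias R n k).
Local Notation S := (bif_poly n k theta).
Local Notation K := (boltzmann 1 (xi n theta)).

Definition interaction (t u : R) : R := 1 + theta * (phi t * phi u).

Lemma interaction_gt0 t u : t \in `[0, 1] -> u \in `[0, 1] -> 0 < interaction t u.
Proof.
move=> /(phi_itv n)/andP[t1 t2] /(phi_itv n)/andP[u1 u2].
have /andP[th0 th1] := theta_itv; rewrite /interaction.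
have : -1 <= phi t * phi u by nra.
by move: (phi t * phi u) => w w1; nra.
Qed.

Lemma boltzmannE t u : t \in `[0, 1] -> u \in `[0, 1] -> K t u = interaction t u.
Proof.
move=> t01 u01; rewrite /boltzmann mul1r /xi odd_root_interaction lnK//.
by rewrite posrE interaction_gt0.
Qed.

Lemma boltzmann_sym t u : K t u = K u t.
Proof. by rewrite /boltzmann /xi !odd_root_interaction [phi t * _]mulrC. Qed.

Lemma hammerstein_kernel (f : R -> R) (t : R) :
    {within `[0, 1], continuous f} -> t \in `[0, 1] ->
  hammerstein k K f t =
  \int[mu]_(u in `[0, 1]) f u ^+ k +
  theta * phi t * \int[mu]_(u in `[0, 1]) (phi u * f u ^+ k).
Proof.
move=> cf t01.
have cfk : {within `[0, 1], continuous (fun u => f u ^+ k)}.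
  move=> u; apply: (@cvg_comp _ _ _ f (fun y => y ^+ k) _ (nbhs (f u))).
    exact: cf.
  exact: exprn_continuous.
have cpf : {within `[0, 1], continuous (fun u => phi u * f u ^+ k)}.
  move=> u; apply: cvgM; last exact: cfk.
  exact: (continuous_subspaceT (@continuous_phi R n)).
rewrite /hammerstein -RintegralZl//; last exact: continuous_integrable_unit.
rewrite -RintegralD//; last 2 first.
- exact: continuous_integrable_unit.
- apply: continuous_integrable_unit => u; apply: cvgM; last exact: cpf.
  exact: cvg_cst.
apply: eq_Rintegral => u u01; rewrite boltzmannE//; last by rewrite inE in u01.
by rewrite /interaction; ring.
Qed.

(** The solution c of c^(k-1) mass x = 1. *)
Definition amplitude (x : R) : R := mass x `^ (- (k.-1)%:R^-1).

Definition profile (x t : R) : R := amplitude x * affine x t.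

Let km1_neq0 : k.-1%:R != 0 :> R.
Proof. by rewrite pnatr_eq0 -lt0n -subn1 subn_gt0. Qed.

Lemma amplitude_gt0 x : -1 < x < 1 -> 0 < amplitude x.
Proof. by move=> /(mass_gt0 n k) m0; rewrite powR_gt0. Qed.

Lemma amplitudeE x : -1 < x < 1 -> amplitude x ^+ k.-1 * mass x = 1.
Proof.
move=> x1; have m0 := mass_gt0 n k x1.
rewrite -powR_mulrn ?powR_ge0// -powRrM mulNr mulVf// powRN powRr1 ?ltW//.
by rewrite mulVf ?gt_eqF.
Qed.

Lemma amplitude_unique x c : -1 < x < 1 -> 0 < c -> c ^+ k.-1 * mass x = 1 ->
  c = amplitude x.
Proof.
move=> x1 c0; rewrite -(amplitudeE x1) => /mulIf cE.
have /cE/eqP : mass x != 0 by rewrite gt_eqF// mass_gt0.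
rewrite eqrXn2 ?ltW ?amplitude_gt0//; first by move/eqP.
by rewrite -subn1 subn_gt0.
Qed.

Lemma continuous_profile x : continuous (profile x).
Proof. by move=> u; apply: cvgM; [exact: cvg_cst|exact: continuous_affine]. Qed.

Lemma profile_gt0 x t : -1 < x < 1 -> t \in `[0, 1] -> 0 < profile x t.
Proof. by move=> x1 t01; rewrite mulr_gt0 ?amplitude_gt0 ?affine_gt0. Qed.

Lemma integral_profileX c x :
  \int[mu]_(u in `[0, 1]) (c * affine x u) ^+ k = c ^+ k * mass x.
Proof.
under eq_Rintegral do rewrite exprMn.
by rewrite RintegralZl//; exact: integrable_affineX.
Qed.

Lemma integral_phi_profileX c x :
  \int[mu]_(u in `[0, 1]) (phi u * (c * affine x u) ^+ k) = c ^+ k * bias x.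
Proof.
under eq_Rintegral do rewrite exprMn mulrCA.
by rewrite RintegralZl//; exact: integrable_phi_affineX.
Qed.

Let exprk (c : R) : c ^+ k = c * c ^+ k.-1.
Proof. by rewrite -exprS prednK// ltnW. Qed.

Lemma profile_fixed_point x : -1 < x < 1 -> x * S.[x] = 0 ->
  positive_fixed_point k K (profile x).
Proof.
move=> x1 Sx; split.
- exact/continuous_subspaceT/continuous_profile.
- by move=> t; exact: profile_gt0.
- move=> t t01; rewrite hammerstein_kernel//; last exact/continuous_subspaceT/continuous_profile.
  rewrite integral_profileX integral_phi_profileX.
  have biasE : theta * bias x = x * mass x.
    by apply/esym/eqP; rewrite -subr_eq0 bif_equation// Sx.
  rewrite exprk /profile /affine.
  have := amplitudeE x1; move: (amplitude x) => c cE.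
  transitivity (c * (c ^+ k.-1 * mass x) + c * c ^+ k.-1 * phi t * (theta * bias x)).
    by ring.
  transitivity (c * (c ^+ k.-1 * mass x) + c * (c ^+ k.-1 * mass x) * (x * phi t)).
    by rewrite biasE; ring.
  by rewrite cE; ring.
Qed.

(** The kernel has rank two, so f is c + theta b phi with c and b the integrals of
f^k and phi f^k; the value c at the zero 1/2 of phi shows that c > 0. *)
Lemma fixed_point_profile f : positive_fixed_point k K f ->
  exists x, [/\ -1 < x < 1, x * S.[x] = 0 &
    forall t, t \in `[0, 1] -> f t = profile x t].
Proof.
move=> [cf f0 fE].
set c := \int[mu]_(u in `[0, 1]) f u ^+ k.
set b := \int[mu]_(u in `[0, 1]) (phi u * f u ^+ k).
have fcb t : t \in `[0, 1] -> f t = c + theta * phi t * b.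
  by move=> t01; rewrite -fE// hammerstein_kernel.
have c0 : 0 < c.
  have h01 : (2^-1 : R) \in `[0, 1] by rewrite in_itv/= invr_ge0 ler0n/= invf_le1 ?ler1n.
  by have := f0 _ h01; rewrite fcb// phi_half mulr0 mul0r addr0.
pose x := theta * b / c.
have faff t : t \in `[0, 1] -> f t = c * affine x t.
  by move=> t01; rewrite fcb// /affine /x; field; rewrite gt_eqF.
have x1 : -1 < x < 1.
  have i0 : (0 : R) \in `[0, 1] by rewrite in_itv/= lexx ler01.
  have i1 : (1 : R) \in `[0, 1] by rewrite in_itv/= lexx ler01.
  have := f0 _ i0; have := f0 _ i1.
  rewrite !faff// !pmulr_rgt0// /affine phi0 phi1 mulr1 mulrN1 => h1 h2.
  by apply/andP; split; lra.
have cE : c = c ^+ k * mass x.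
  rewrite -integral_profileX; apply: eq_Rintegral => u u01.
  by rewrite faff//; rewrite inE in u01.
have bE : b = c ^+ k * bias x.
  rewrite -integral_phi_profileX; apply: eq_Rintegral => u u01.
  by rewrite faff//; rewrite inE in u01.
have cm : c ^+ k.-1 * mass x = 1.
  by apply: (mulfI (lt0r_neq0 c0)); rewrite mulr1 mulrA -exprk -cE.
exists x; split => //.
  rewrite -bif_equation//; apply/eqP; rewrite subr_eq0; apply/eqP.
  apply: (mulfI (lt0r_neq0 c0)).
  have c1 : c ^+ k.-1 != 0 by apply: lt0r_neq0; rewrite exprn_gt0.
  apply: (mulfI c1).
  transitivity (x * c * (c ^+ k.-1 * mass x)); first by ring.
  have xc : x * c = theta * b by rewrite /x divfK ?gt_eqF.
  by rewrite cm mulr1 xc bE exprk; ring.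
by move=> t t01; rewrite faff// (amplitude_unique x1 c0 cm).
Qed.

End fixed_points.

(** * Splitting Gibbs measures on the tree *)
Section spin_integrals.
Variable R : realType.
Local Notation mu := (@lebesgue_measure R).
Local Notation lambda := (@spin_lebesgue R).

Lemma spin_val_itv (t : spin R) : spin_val t \in `[0, 1].
Proof. by rewrite in_itv/=; exact: (valP t). Qed.

Lemma spin_lebesgue_preimage (C : set R) :
  lambda (@spin_val R @^-1` C) = mu (C `&` `[0, 1]).
Proof. by rewrite /spin_lebesgue image_spin_val. Qed.

Lemma integral_spin_lebesgue (h : R -> R) : measurable_fun setT h ->
  (forall u, u \in `[0, 1] -> 0 <= h u) ->
  (\int[lambda]_t (h (spin_val t))%:E = \int[mu]_(u in `[0%R, 1%R]) (h u)%:E)%E.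
Proof.
move=> mh h0; have sval01 : @spin_val R @^-1` `[0, 1] = setT.
  by apply/seteqP; split => // t _; exact: spin_val_itv.
have mval : measurable_fun setT (@spin_val R : spin R -> measurableTypeR R).
  exact: measurable_spin_val.
pose val_mfun : {mfun spin R >-> measurableTypeR R} :=
  HB.pack (@spin_val R : spin R -> measurableTypeR R)
    (isMeasurableFun.Build _ _ _ _ _ mval).
transitivity (\int[distribution lambda val_mfun]_(u in `[0%R, 1%R]) (h u)%:E)%E.
  rewrite -[X in (\int[_]_(t in X) _)%E]sval01; symmetry.
  apply: (@ge0_integral_pushforward _ _ _ _ _ _ mval lambda _ (EFin \o h)) => //.
  - by apply/measurable_EFinP; exact: measurable_funTS.
  - by move=> u /[!inE] u01; rewrite lee_fin h0.
apply: (@eq_measure_integral _ (measurableTypeR R) R `[0, 1] mu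
  (distribution lambda val_mfun)) => C mC C01.
by rewrite [LHS]spin_lebesgue_preimage setIidl.
Qed.

End spin_integrals.

Section gibbs_measures.
Context (R : realType) (n k : nat) (theta : R) (V : choiceType) (e : rel V) (x0 : V).
Hypothesis k_gt1 : (1 < k)%N.
Hypothesis theta_itv : 0 <= theta < 1.
Hypothesis tree : cayley_tree e k.
Local Notation T := (spin R).
Local Notation Om := (config V T).
Local Notation mu := (@lebesgue_measure R).
Local Notation lambda := (@spin_lebesgue R).
Local Notation ball := (graph_ball e x0).
Local Notation dist x := (gdist e x x0).
Local Notation par := (parent e x0).
Local Notation off := (offspring k x0).
Local Notation K := (boltzmann 1 (xi n theta)).
Local Notation S := (bif_poly n k theta).
Local Notation profile := (@profile R n k).
Local Notation kernel := (@interaction R n theta).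
Local Notation PA A := (partial_product (@spin_lebesgue R) A : probability Om R).

Lemma measurable_phi : measurable_fun setT (@phi R n).
Proof. by apply: continuous_measurable_fun; exact: continuous_phi. Qed.

Lemma measurable_profile x : measurable_fun setT (profile x).
Proof. by apply: continuous_measurable_fun; exact: continuous_profile. Qed.

Lemma measurable_interaction d (X : measurableType d) (f g : X -> R) :
  measurable_fun setT f -> measurable_fun setT g ->
  measurable_fun setT (fun s => kernel (f s) (g s)).
Proof.
move=> mf mg; apply: measurable_funD; first exact: measurable_cst.
apply: measurable_funM; first exact: measurable_cst.
by apply: measurable_funM; (apply: measurableT_comp; first exact: measurable_phi).
Qed.

Lemma measurable_spin_at v : measurable_fun setT (fun s : Om => spin_val (s v)).
Proof. exact: (measurableT_comp (@measurable_spin_val R) (measurable_coord v)). Qed.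

(** The exponent of f is the number of children, which is k except at the root.
It makes the weights consistent from radius 0 on, and agrees with the weight of
the Gibbs measure for positive radius ([gibbs_weight_tree]). *)
Definition tree_weight (f : R -> R) N (s : Om) : R :=
  (\prod_(y <- ball N | y != x0) kernel (spin_val (s (par y))) (spin_val (s y))) *
  \prod_(y <- ball N | dist y == N) f (spin_val (s y)) ^+ off y.

Lemma gibbs_weight_tree (f : R -> R) N (s : config (ball N) T) : (0 < N)%N ->
  gibbs_weight k K f s = tree_weight f N (extend s).
Proof.
move=> N0.
have restrict_extend : @restriction R V (ball N) (extend s) = s.
  by apply/funext => y; rewrite /restriction /extend valK.
rewrite /gibbs_weight -{1}restrict_extend.
rewrite (prod_edges x0 tree (@boltzmann_sym R n theta) N).
congr (_ * _).
  apply: eq_bigr => y _; apply: boltzmannE => //; exact: spin_val_itv.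
rewrite [RHS](big_seq_fsetE _ _ (fun y => dist y == N)
  (fun y => f (spin_val (extend s y)) ^+ off y))/=.
apply: eq_big => [y|y /set_mem yN].
  by apply/idP/eqP => [/set_mem//|yN]; apply/mem_set.
rewrite /extend valK /offspring ifF//; apply/negP => /eqP yx0.
by move: yN; rewrite /graph_sphere/= yx0 (gdist_root e x0) => N0'; rewrite -N0' in N0.
Qed.

Lemma eq_gibbs_weight (f g : R -> R) N (s : config (ball N) T) :
  (forall t, t \in `[0, 1] -> f t = g t) ->
  gibbs_weight k K f s = gibbs_weight k K g s.
Proof.
move=> fg; congr (_ * _); apply: eq_bigr => y _.
by rewrite fg//; exact: spin_val_itv.
Qed.

Lemma prod_ballS (F : V -> R) N :
  \prod_(y <- ball N.+1 | y != x0) F y =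
  (\prod_(y <- ball N | y != x0) F y) * \prod_(y <- ball N.+1 | dist y == N.+1) F y.
Proof.
rewrite (bigID (fun y => dist y == N.+1))/= mulrC; congr (_ * _).
  rewrite -big_filter -[RHS]big_filter; apply: perm_big.
  apply: uniq_perm; rewrite ?filter_uniq// => y; rewrite !mem_filter !(in_ball x0 tree).
  by rewrite -andbA; congr andb; lia.
apply: eq_bigl => y; rewrite -(gdist_eq0 x0 tree).
by case: (dist y) => [|m] //=; rewrite andbT.
Qed.

Section density.
Variable x : R.
Hypothesis x_itv : -1 < x < 1.
Hypothesis x_sol : x * S.[x] = 0.
Local Notation f := (profile x).

Lemma profile_spin_gt0 (t : T) : 0 < f (spin_val t).
Proof. by apply: profile_gt0 => //; exact: spin_val_itv. Qed.

Lemma integral_profile_spin (t : T) :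
  (\int[lambda]_u (kernel (spin_val t) (spin_val u) * f (spin_val u) ^+ k)%:E =
   (f (spin_val t))%:E)%E.
Proof.
have [_ _ fE] := profile_fixed_point k_gt1 theta_itv x_itv x_sol.
have cont : continuous (fun u : R => kernel (spin_val t) u * f u ^+ k).
  move=> u; apply: cvgM.
    apply: cvgD; first exact: cvg_cst.
    apply: cvgM; first exact: cvg_cst.
    by apply: cvgM; [exact: cvg_cst|exact: continuous_phi].
  by apply: continuous_funX; exact: continuous_profile.
rewrite -fE ?spin_val_itv// (integral_spin_lebesgue
  (h := fun u => kernel (spin_val t) u * f u ^+ k)).
- rewrite /hammerstein /Rintegral -[LHS]fineK; last first.
    apply: integrable_fin_num => //.
    by apply/continuous_integrable_unit/continuous_subspaceT.
  congr (fine _)%:E; apply: eq_integral => u /[!inE] u01.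
  by rewrite boltzmannE// spin_val_itv.
- exact: continuous_measurable_fun.
- move=> u u01; rewrite mulr_ge0 ?exprn_ge0//.
    by rewrite ltW// interaction_gt0// spin_val_itv.
  by rewrite ltW// profile_gt0.
Qed.

(** The mass of the weight in the ball of radius 0, hence in all balls. *)
Definition root_mass : R := \int[mu]_(u in `[0, 1]) f u ^+ k.+1.

Lemma measurable_fX m : measurable_fun setT (fun u => f u ^+ m).
Proof. by apply: measurable_funX; exact: measurable_profile. Qed.

Lemma integral_root_spin :
  (\int[lambda]_u (f (spin_val u) ^+ k.+1)%:E = root_mass%:E)%E.
Proof.
rewrite (integral_spin_lebesgue (h := fun u => f u ^+ k.+1)).
- rewrite /root_mass /Rintegral fineK//; apply: integrable_fin_num => //.
  apply/continuous_integrable_unit/continuous_subspaceT.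
  by apply: continuous_funX; exact: continuous_profile.
- exact: measurable_fX.
- by move=> u u01; rewrite exprn_ge0// ltW// profile_gt0.
Qed.

Lemma root_mass_gt0 : 0 < root_mass.
Proof.
rewrite -lte_fin -integral_root_spin.
rewrite -[X in (X < _)%E](integral_cst_probability (@spin_lebesgue R : probability T R) 0%E).
apply: lt_integral_probability => //.
- apply/measurable_EFinP; apply: (measurableT_comp (measurable_fX _)).
  exact: measurable_spin_val.
- by move=> t; rewrite lte_fin exprn_gt0// profile_spin_gt0.
- by rewrite integral_root_spin ltry.
Qed.

(** The balls, preceded by the empty set, on which the density is 1: the first
consistency condition is the normalization. *)
Definition exhaustion N : {fset V} := if N is M.+1 then ball M else fset0.

Definition tree_density N (s : Om) : R :=
  if N is M.+1 then tree_weight f M s / root_mass else 1.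

Lemma measurable_tree_weight N : measurable_fun setT (tree_weight f N).
Proof.
have mprod (h : V -> Om -> R) (Q : pred V) : (forall y, measurable_fun setT (h y)) ->
    measurable_fun setT (fun s => \prod_(y <- ball N | Q y) h y s).
  move=> mh; rewrite (_ : (fun s => _) =
      fun s => \prod_(y <- [seq y <- ball N | Q y]) h y s); last first.
    by apply/funext => s; rewrite big_filter.
  by apply: measurable_prod => y _.
apply: measurable_funM; apply: mprod => y.
  by apply: measurable_interaction; exact: measurable_spin_at.
apply: measurable_funX; apply: (measurableT_comp (measurable_profile x)).
exact: measurable_spin_at.
Qed.

Lemma tree_weight_gt0 N s : 0 < tree_weight f N s.
Proof.
rewrite mulr_gt0// prodr_gt0// => y _.
  by rewrite interaction_gt0// spin_val_itv.
by rewrite exprn_gt0// profile_spin_gt0.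
Qed.

Lemma parent_in_ball N y : y \in ball N -> y != x0 -> par y \in ball N.
Proof.
move=> yN y0; have [_ dp] := parentP tree y0.
by move: yN; rewrite !(in_ball x0 tree) -dp => /ltnW.
Qed.

Lemma tree_weight_splice N s t :
  tree_weight f N.+1 (splice (ball N) (s, t)) =
  (\prod_(y <- ball N | y != x0) kernel (spin_val (s (par y))) (spin_val (s y))) *
  \prod_(y <- [seq y <- ball N.+1 | dist y == N.+1])
    (kernel (spin_val (s (par y))) (spin_val (t y)) * f (spin_val (t y)) ^+ k).
Proof.
rewrite /tree_weight prod_ballS -mulrA; congr (_ * _).
  rewrite big_seq_cond [RHS]big_seq_cond; apply: eq_bigr => y /andP[yN y0].
  by rewrite /splice parent_in_ball// yN.
rewrite big_filter -big_split/=; apply: eq_bigr => y /eqP dy.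
have y0 : y != x0 by rewrite -(gdist_eq0 x0 tree) dy.
have [_ [dp]] := parentP tree y0; rewrite dy in dp; case: dp => dp.
rewrite /splice !(in_ball x0 tree) dy dp leqnn ltnn /offspring (negPf y0)//.
Qed.

(** Integrating out a vertex y of the last sphere gives, by the fixed point
equation, f at the parent of y; the parents then carry f to the power of their
number of children. *)
Lemma resample_tree_density N s :
  resample lambda exhaustion N (EFin \o tree_density N.+1) s = (tree_density N s)%:E.
Proof.
rewrite /resample; case: N => [|N] /=.
  have ball0 : ball 0 = [fset x0]%fset.
    by apply/fsetP => y; rewrite (in_ball x0 tree) inE leqn0 (gdist_eq0 x0 tree).
  pose h (v : V) (u : T) := f (spin_val u) ^+ k.+1 / root_mass.
  transitivity (\int[PA (ball 0)]_t (\prod_(v <- [:: x0]) h v (t v))%:E)%E.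
    apply: eq_integral => t _; congr (_%:E).
    have pb : perm_eq (ball 0) [:: x0].
      by apply: uniq_perm => // y; rewrite ball0 !inE.
    rewrite /tree_weight !(perm_big _ pb)/= !big_cons !big_nil eqxx gdist_root eqxx.
    by rewrite mul1r !mulr1 /h /offspring eqxx /splice in_fset0.
  rewrite integral_partial_product//.
  - rewrite big_seq1 ball0 inE eqxx /h.
    under eq_integral do rewrite EFinM.
    rewrite ge0_integralZr//.
    + by rewrite integral_root_spin -EFinM divff// gt_eqF// root_mass_gt0.
    + apply/measurable_EFinP; apply: (measurableT_comp (measurable_fX _)).
      exact: measurable_spin_val.
    + by move=> t _; rewrite lee_fin exprn_ge0// ltW// profile_spin_gt0.
    + by rewrite lee_fin invr_ge0 ltW// root_mass_gt0.
  - move=> v; apply: measurable_funM; last exact: measurable_cst.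
    by apply: (measurableT_comp (measurable_fX _)); exact: measurable_spin_val.
  - move=> v u; rewrite divr_ge0 ?exprn_ge0//; first by rewrite ltW// profile_spin_gt0.
    by rewrite ltW// root_mass_gt0.
pose h (v : V) (u : T) := kernel (spin_val (s (par v))) (spin_val u) * f (spin_val u) ^+ k.
pose c := \prod_(y <- ball N | y != x0) kernel (spin_val (s (par y))) (spin_val (s y)).
pose r := [seq y <- ball N.+1 | dist y == N.+1].
have c0 : 0 <= c.
  by rewrite prodr_ge0// => y _; rewrite ltW// interaction_gt0// spin_val_itv.
have mh v : measurable_fun setT (h v).
  apply: measurable_funM.
    by apply: measurable_interaction; [exact: measurable_cst|exact: measurable_spin_val].
  by apply: (measurableT_comp (measurable_fX _)); exact: measurable_spin_val.
have h0 v u : 0 <= h v u.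
  rewrite mulr_ge0 ?exprn_ge0//; last by rewrite ltW// profile_spin_gt0.
  by rewrite ltW// interaction_gt0// spin_val_itv.
transitivity (\int[PA (ball N.+1)]_t ((c / root_mass)%:E * (\prod_(v <- r) h v (t v))%:E))%E.
  apply: eq_integral => t _; rewrite tree_weight_splice -EFinM; congr (_%:E).
  by rewrite mulrAC.
rewrite ge0_integralZl//; last 3 first.
- apply/measurable_EFinP; apply: measurable_prod_comp => // v; exact: measurable_coord.
- by move=> t _; rewrite lee_fin prodr_ge0.
- by rewrite lee_fin divr_ge0// ltW// root_mass_gt0.
rewrite integral_partial_product//; last by rewrite filter_uniq// fset_uniq.
have -> : (\prod_(v <- r) (if v \in ball N.+1 then \int[lambda]_u (h v u)%:E
      else (h v point)%:E) =
    \prod_(v <- r) (f (spin_val (s (par v))))%:E)%E.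
  rewrite big_seq [RHS]big_seq; apply: eq_bigr => v; rewrite mem_filter => /andP[_ ->].
  exact: integral_profile_spin.
rewrite prodEFin -EFinM; congr (_%:E).
rewrite big_filter (prod_sphere_parent x0 tree _ (fun y => f (spin_val (s y)))).
by rewrite /tree_weight mulrAC.
Qed.

Definition has_tree_density (m : probability Om R) : Prop :=
  forall N (D : set Om), measurable D -> determined (exhaustion N) D ->
    m D = (\int[PA (exhaustion N)]_(s in D) (tree_density N s)%:E)%E.

Lemma tree_gibbs_exists : exists m, has_tree_density m.
Proof.
apply: consistent_densities_extension => //.
- case=> [|N] /=; first exact: fsub0set.
  exact: (ball_mono x0 tree).
- by move=> v; exists (dist v).+1; rewrite /= (in_ball x0 tree).
- case=> [|N]; first exact: measurable_cst.
  by apply: measurable_funM; [exact: measurable_tree_weight|exact: measurable_cst].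
- by case=> [|N] s //=; rewrite divr_gt0 ?tree_weight_gt0 ?root_mass_gt0.
- exact: resample_tree_density.
Qed.

Section marginals.
Variable m : probability Om R.
Hypothesis mE : has_tree_density m.

Lemma restriction_extend N (s : config (ball N) T) : restriction (extend s) = s.
Proof. by apply/funext => y; rewrite /restriction /extend valK. Qed.

Lemma measurable_restriction N :
  measurable_fun setT (@restriction R V (ball N)).
Proof. by apply: measurable_configP => y; exact: measurable_coord. Qed.

Lemma integral_gibbs_weight N (B : set (config (ball N) T)) c :
    (0 < N)%N -> 0 <= c -> measurable B ->
  (\int[product_probability lambda (ball N)]_(s in B) (c * gibbs_weight k K f s)%:E =
   \int[PA (ball N)]_(s in @restriction R V (ball N) @^-1` B) (c * tree_weight f N s)%:E)%E.
Proof.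
move=> N0 c0 mB; set rB := @restriction R V (ball N) @^-1` B.
pose w : Om -> \bar R := fun s => (c * tree_weight f N s)%:E.
have mrB : measurable rB.
  by rewrite -[X in measurable X]setTI; exact: measurable_restriction.
have extB : @extend V _ T (ball N) @^-1` rB = B.
  by apply/seteqP; split => s; rewrite /rB /= restriction_extend.
transitivity (\int[product_probability lambda (ball N)]_(s in
    @extend V _ T (ball N) @^-1` rB) (w \o @extend V _ T (ball N)) s)%E.
  by rewrite extB; apply: eq_integral => s _; rewrite /w/= gibbs_weight_tree.
symmetry.
apply: (@ge0_integral_pushforward _ _ _ _ _ _ (@measurable_extend _ _ _ (ball N))).
- exact: mrB.
- apply/measurable_EFinP/measurable_funTS; apply: measurable_funM.
    exact: measurable_cst.
  exact: measurable_tree_weight.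
- by move=> s _ /=; rewrite lee_fin mulr_ge0// ltW// tree_weight_gt0.
Qed.

Lemma partition_functionE N : (0 < N)%N -> partition_function e x0 k K f N = root_mass.
Proof.
move=> N0; rewrite /partition_function /Rintegral.
have -> : (\int[product_probability lambda (ball N)]_s (gibbs_weight k K f s)%:E =
           root_mass%:E)%E; last by [].
transitivity (\int[product_probability lambda (ball N)]_s (1 * gibbs_weight k K f s)%:E)%E.
  by apply: eq_integral => s _; rewrite mul1r.
rewrite integral_gibbs_weight// preimage_setT.
have : m setT = 1%E by exact: probability_setT.
rewrite (mE (N := N.+1))//= => I1.
rewrite -[RHS]mule1 -I1 -ge0_integralZl//; last 3 first.
- apply/measurable_EFinP; apply: measurable_funM; last exact: measurable_cst.
  exact: measurable_tree_weight.
- by move=> s _; rewrite lee_fin divr_ge0// ltW ?tree_weight_gt0 ?root_mass_gt0.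
- by rewrite lee_fin ltW// root_mass_gt0.
apply: eq_integral => s _; rewrite -EFinM mul1r mulrC divfK// gt_eqF//.
exact: root_mass_gt0.
Qed.

Lemma gibbs_marginal N (B : set (config (ball N) T)) : (0 < N)%N -> measurable B ->
  pushforward m (@restriction R V (ball N)) B =
  (\int[product_probability lambda (ball N)]_(s in B)
     ((partition_function e x0 k K f N)^-1 * gibbs_weight k K f s)%:E)%E.
Proof.
move=> N0 mB; rewrite partition_functionE// integral_gibbs_weight//; last first.
  by rewrite invr_ge0 ltW// root_mass_gt0.
rewrite /pushforward (mE (N := N.+1))//=.
- by apply: eq_integral => s _; rewrite mulrC.
- by rewrite -[X in measurable X]setTI; exact: measurable_restriction.
- move=> s s' ss' /=; congr B; apply/funext => y; rewrite /restriction.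
  by rewrite ss'// fsvalP.
Qed.

(** The event only concerns the ball of radius 0, where the density is
f^(k+1) / root_mass. *)
Lemma root_marginal (C : set T) : measurable C ->
  m [set s | C (s x0)] =
  (\int[lambda]_(t in C) (f (spin_val t) ^+ k.+1 / root_mass)%:E)%E.
Proof.
move=> mC.
have mD : measurable [set s : Om | C (s x0)].
  by rewrite -[X in measurable X]setTI; exact: (measurable_coord x0).
have ball0 : ball 0 = [fset x0]%fset.
  by apply/fsetP => y; rewrite (in_ball x0 tree) inE leqn0 (gdist_eq0 x0 tree).
rewrite (mE (N := 1)) //; last first.
  by move=> s s' ss' /=; rewrite ss'//= ball0 inE.
rewrite [LHS]integral_mkcond [RHS]integral_mkcond.
pose h (v : V) (t : T) := f (spin_val t) ^+ k.+1 / root_mass * \1_C t.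
have hm v : measurable_fun setT (h v).
  apply: measurable_funM; last exact: measurable_indic.
  apply: measurable_funM; last exact: measurable_cst.
  by apply: (measurableT_comp (measurable_fX _)); exact: measurable_spin_val.
have h0 v t : 0 <= h v t.
  rewrite mulr_ge0// divr_ge0 ?exprn_ge0//; first by rewrite ltW// profile_spin_gt0.
  by rewrite ltW// root_mass_gt0.
transitivity (\int[PA (ball 0)]_t (\prod_(v <- [:: x0]) h v (t v))%:E)%E.
  apply: eq_integral => s _; rewrite epatch_indic /= big_seq1 -EFinM; congr (_%:E).
  have pb : perm_eq (ball 0) [:: x0].
    by apply: uniq_perm => // y; rewrite ball0 !inE.
  rewrite /tree_weight !(perm_big _ pb)/= !big_cons !big_nil eqxx gdist_root eqxx.
  by rewrite mul1r !mulr1 /h /offspring eqxx !indicE.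
rewrite integral_partial_product// big_seq1 ball0 inE eqxx.
by apply: eq_integral => t _; rewrite epatch_indic.
Qed.

End marginals.

End density.

Local Notation is_tisgm := (@ti_splitting_gibbs_measure R V e x0 k 1 (xi n theta)).

(** A box with finitely many constrained coordinates lies over some ball. *)
Lemma marginals_measure_eq (m m' : probability Om R) :
  (forall N, (0 < N)%N -> forall B : set (config (ball N) T), measurable B ->
     pushforward m (@restriction R V (ball N)) B =
     pushforward m' (@restriction R V (ball N)) B) ->
  measure_eq m m'.
Proof.
move=> mm'; apply: config_measure_eq => r B _ mB.
pose N := (\max_(v <- r) dist v).+1.
have rN v : v \in r -> v \in ball N.
  by move=> vr; rewrite (in_ball x0 tree) leqW//; exact: leq_bigmax_seq.
have boxE : box r B =
    @restriction R V (ball N) @^-1` (@extend V _ T (ball N) @^-1` box r B).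
  have ext s v : v \in r -> extend (@restriction R V (ball N) s) v = s v.
    by move=> vr; rewrite /extend /restriction insubT ?rN.
  by apply/seteqP; split => s sB v vr; have := sB v vr; rewrite ext.
rewrite boxE; apply: (mm' N) => //.
rewrite -[X in measurable X]setTI; apply: measurable_extend => //.
exact: measurable_box.
Qed.

Lemma tree_gibbs_tisgm x (m : probability Om R) :
  -1 < x < 1 -> x * S.[x] = 0 -> has_tree_density x m -> is_tisgm m.
Proof.
move=> x1 Sx mE; exists (profile x); first exact: profile_fixed_point.
by move=> N N0 B mB; exact: gibbs_marginal.
Qed.

Lemma tisgm_tree_gibbs (m : probability Om R) : is_tisgm m ->
  exists x, [/\ -1 < x < 1, x * S.[x] = 0 &
    forall m' : probability Om R, has_tree_density x m' -> measure_eq m m'].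
Proof.
case=> f ff mE; have [x [x1 Sx fE]] := fixed_point_profile k_gt1 theta_itv ff.
exists x; split=> // m' m'E; apply: marginals_measure_eq => N N0 B mB.
rewrite mE// (gibbs_marginal x1 m'E)//.
have -> : partition_function e x0 k K f N = partition_function e x0 k K (profile x) N.
  by apply: eq_Rintegral => s _; exact: eq_gibbs_weight.
by apply: eq_integral => s _; rewrite (eq_gibbs_weight _ fE).
Qed.

Lemma spin_lebesgue_neq0 (a b : R) : 0 <= a -> a < b -> b <= 1 ->
  lambda (@spin_val R @^-1` `[a, b]) != 0%E.
Proof.
move=> a0 ab b1; rewrite spin_lebesgue_preimage setIidl; last first.
  move=> u /=; rewrite !in_itv/= => /andP[au ub].
  by rewrite (le_trans a0)// (le_trans ub).
rewrite [X in X != _]lebesgue_measure_itv/= lte_fin ab -EFinD.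
by apply/eqP => -[] /eqP; rewrite subr_eq0 gt_eqF.
Qed.

(** The densities of the root spins agree almost everywhere, hence at a point of
[0, 1/3] and at a point of [1/2, 1]. As (1 + x phi) / (1 + x' phi) takes the same
value at these two points, where phi differs, x = x'. *)
Lemma tree_gibbs_injective x x' (m m' : probability Om R) :
    -1 < x < 1 -> x * S.[x] = 0 -> -1 < x' < 1 -> x' * S.[x'] = 0 ->
    has_tree_density x m -> has_tree_density x' m' ->
  measure_eq m m' -> x = x'.
Proof.
move=> x1 Sx x1' Sx' mE mE' mm'.
pose q y (t : T) := (profile y (spin_val t) ^+ k.+1 / root_mass y)%:E.
have mq y : measurable_fun setT (q y).
  apply/measurable_EFinP; apply: measurable_funM; last exact: measurable_cst.
  by apply: (measurableT_comp (measurable_fX y k.+1)); exact: measurable_spin_val.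
have q0 y t : -1 < y < 1 -> (0 <= q y t)%E.
  move=> y1; rewrite lee_fin divr_ge0 ?exprn_ge0//.
    by rewrite ltW// profile_spin_gt0.
  by rewrite ltW// root_mass_gt0.
have int_q : lambda.-integrable setT (q x).
  have qT : (\int[lambda]_t q x t = 1)%E.
    by rewrite -(root_marginal x1 mE measurableT); exact: probability_setT.
  apply/integrableP; split => //.
  rewrite (eq_integral (q x)) ?qT ?ltry// => t _.
  by rewrite gee0_abs ?q0.
have : ae_eq lambda setT (q x) (q x').
  apply: (integral_ae_eq measurableT int_q (mq x')) => C _ mC.
  rewrite -(root_marginal x1 mE)// -(root_marginal x1' mE')//.
  apply: mm'; rewrite -[X in measurable X]setTI; exact: (measurable_coord x0).
case=> N [mN N0 sN].
have eq_at a b : 0 <= a -> a < b -> b <= 1 ->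
    exists2 t : T, a <= spin_val t <= b & q x t = q x' t.
  move=> a0 ab b1; apply: contrapT => nt.
  have sub : @spin_val R @^-1` `[a, b] `<=` N.
    move=> t /=; rewrite in_itv/= => tab; apply: sN => /= /(_ I) qt.
    by apply: nt; exists t.
  have := spin_lebesgue_neq0 a0 ab b1; apply/negP; rewrite negbK -measure_le0.
  rewrite -[leRHS]N0; apply: le_measure => //; rewrite inE//.
  by rewrite -[X in measurable X]setTI; exact: measurable_spin_val.
have [t /andP[t0 t1] qt] := eq_at 0 3^-1 (lexx 0) ltac:(lra) ltac:(lra).
have [u /andP[u0 u1] qu] := eq_at 2^-1 1 ltac:(lra) ltac:(lra) (lexx 1).
have phi_tu : phi n (spin_val t) != phi n (spin_val u).
  by rewrite lt_eqF// ltr_phi; lra.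
(* The factors c x and c x' cancel between the two points. *)
pose c y := amplitude n k y ^+ k.+1 / root_mass y.
have c_gt0 y : -1 < y < 1 -> 0 < c y.
  by move=> y1; rewrite divr_gt0 ?exprn_gt0 ?amplitude_gt0 ?root_mass_gt0.
have qE y (s : T) : q y s = (c y * affine n y (spin_val s) ^+ k.+1)%:E.
  by rewrite /q /profile exprMn mulrAC.
have aff_gt0 y (s : T) : -1 < y < 1 -> 0 < affine n y (spin_val s).
  by move=> y1; apply: affine_gt0 => //; exact: spin_val_itv.
have cross : affine n x (spin_val t) * affine n x' (spin_val u) =
             affine n x (spin_val u) * affine n x' (spin_val t).
  apply/eqP; rewrite -(@eqrXn2 _ k.+1)//; last 2 first.
  - by rewrite ltW// mulr_gt0 ?aff_gt0.
  - by rewrite ltW// mulr_gt0 ?aff_gt0.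
  rewrite !exprMn.
  move: qt qu; rewrite !qE => -[qt] [qu].
  have cc : c x * c x' != 0 by rewrite mulf_neq0 ?gt_eqF ?c_gt0.
  apply/eqP/(mulfI cc); rewrite mulrACA qt -qu; ring.
move: cross phi_tu; rewrite /affine; move: (phi n (spin_val t)) (phi n (spin_val u)).
move=> a b ab; rewrite -subr_eq0 => ab0.
apply/eqP; rewrite -subr_eq0; apply/eqP/(mulIf ab0); rewrite mul0r.
by move: ab => /eqP; rewrite -subr_eq0 => /eqP <-; ring.
Qed.

Lemma exactly_tisgm j (sol : 'I_j -> R) : injective sol ->
    (forall i, -1 < sol i < 1 /\ sol i * S.[sol i] = 0) ->
    (forall x, -1 < x < 1 -> x * S.[x] = 0 -> exists i, x = sol i) ->
  exactly_probabilities j is_tisgm.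
Proof.
move=> sol_inj sol_sol sol_all.
have /choice[m mP] : forall i, exists m, has_tree_density (sol i) m.
  by move=> i; have [? ?] := sol_sol i; exact: tree_gibbs_exists.
exists m; split.
- by move=> i; have [s1 Ss] := sol_sol i; exact: (tree_gibbs_tisgm s1 Ss (mP i)).
- move=> i i' mm'; apply: sol_inj.
  have [s1 Ss] := sol_sol i; have [s1' Ss'] := sol_sol i'.
  exact: (tree_gibbs_injective s1 Ss s1' Ss' (mP i) (mP i')).
- move=> nu /tisgm_tree_gibbs[x [x1 Sx nuE]].
  have [i xE] := sol_all x x1 Sx; exists i; apply: nuE; rewrite xE; exact: mP.
Qed.

End gibbs_measures.

Theorem theorem3p1 (R : realType) (n k : nat) (theta : R)
    (V : choiceType) (e : rel V) (x0 : V)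
    (hk : (2 <= k)%N) (htheta : 0 <= theta < 1) (htree : cayley_tree e k) :
  let theta_c : R := (2 * n + 3)%:R / (k * (2 * n + 1))%:R in
  let is_tisgm := @ti_splitting_gibbs_measure R V e x0 k 1 (xi n theta) in
  (0 <= theta <= theta_c -> exactly_probabilities 1 is_tisgm) /\
  (theta_c < theta < 1 -> exactly_probabilities 3 is_tisgm).
Proof.
move=> theta_c is_tisgm.
have theta_c_gt0 : 0 < theta_c.
  by rewrite divr_gt0// ltr0n ?muln_gt0 ?addn_gt0 ?orbT// andbT ltnW.
have coef0 : bif_coef n k theta 0 = 1 - theta / theta_c.
  rewrite bif_coef0 /theta_c invf_div natrM -mul2n -addn1 -addnA.
  by congr (_ - _ * _); rewrite mulrA.
have S0 : 0 * (bif_poly n k theta).[0] = 0 by rewrite mul0r.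
have zero_itv : -1 < (0 : R) < 1 by rewrite oppr_lt0 ltr01.
split=> [/andP[_ le_c]|/andP[lt_c _]].
  have c0 : 0 <= bif_coef n k theta 0.
    by rewrite coef0 subr_ge0 ler_pdivrMr// mul1r.
  apply: (@exactly_tisgm _ _ _ _ _ _ x0 hk htheta htree 1 (fun=> 0)) => //.
    by move=> i j _; rewrite !ord1.
  move=> x x1 Sx; exists ord0.
  exact: (bif_solutions_subcritical htheta c0 x1 Sx).
have c0 : bif_coef n k theta 0 < 0.
  by rewrite coef0 subr_lt0 ltr_pdivlMr// mul1r.
have [r [/andP[r0 r1] Sr r_all]] := bif_solutions_supercritical htheta c0.
pose sol (i : 'I_3) : R := nth 0 [:: 0; r; - r] i.
apply: (@exactly_tisgm _ _ _ _ _ _ x0 hk htheta htree 3 sol).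
- have us : uniq [:: 0; r; - r].
    rewrite /= !inE !negb_or eq_sym gt_eqF// eq_sym oppr_eq0 gt_eqF//=.
    by rewrite andbT; apply/eqP => rN; lra.
  by move=> i j /eqP; rewrite nth_uniq// => /eqP/val_inj.
- case=> [[|[|[|//]]]] i3; rewrite /sol/=; split => //.
  + by rewrite r1 (lt_trans _ r0)// oppr_lt0.
  + by rewrite Sr mulr0.
  + by rewrite ltrN2 r1 (lt_trans _ ltr01)// oppr_lt0.
  + by rewrite bif_polyN Sr mulr0.
- move=> x x1 Sx; have [->|->|->] := r_all x x1 Sx.
  + by exists (inord 0); rewrite /sol inordK.
  + by exists (inord 1); rewrite /sol inordK.
  + by exists (inord 2); rewrite /sol inordK.
Qed.
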